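(* Let $r:\mathbb{R}\to[0,c_1]$ be a bounded differentiable non-negative function with bounded derivative $|r'|\le c_2$, and suppose that for some $c^{*}>0$ one has $r(t)\in[c^{*},c_1]\subset(0,c_1]$ for all $t\ge0$. Suppose that $|p-nq|>1$. Let $G=\frac{r^2(F)}{F^2}S^{+}XX^{\top}S^{+}S$, $H=AGA^{-1}$ and $\tilde Y=\sqrt q\,YA^{-1}$. Then $$\mathrm E_\theta\left[\left|\mathrm{div}_{\mathrm{vec}(\tilde Y)}\mathrm{vec}(\tilde YH)\right|\right]<\infty\quad\text{if and only if}\quad \mathrm P_\theta(qR>2)=1.$$
   Context: Fix integers $n,p,q\ge1$, a $p\times q$ real matrix $\theta$ and a $p\times p$ symmetric positive definite matrix $\Sigma$. The random $p\times q$ matrix $X\sim\mathcal N_{p\times q}(\theta,\Sigma\otimes I_q)$ has independent columns, the $j$-th column being $\mathcal N_p(\theta_{\cdot j},\Sigma)$. The random $nq\times p$ matrix $Y\sim\mathcal N_{nq\times p}(0,I_{nq}\otimes(\Sigma/q))$ has i.i.d. rows distributed as $\mathcal N_p(0,\Sigma/q)$. Set $S=Y^{\top}Y$; $X$ and $S$ are independent. $\mathrm P_\theta,\mathrm E_\theta$ denote probability and expectation under this model. $S^{+}$ is the Moore–Penrose inverse of $S$, $R=\mathrm{rank}(S)$, and $F=\mathrm{tr}(X^{\top}S^{+}X)$ (which is positive almost surely). $A$ is the symmetric positive definite square root of $\Sigma$. $\mathrm{div}_{\mathrm{vec}(\tilde Y)}\mathrm{vec}(\tilde YH)=\sum_{\alpha,i}\partial(\tilde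 YH)_{\alpha i}/\partial\tilde Y_{\alpha i}$, where $X$ is held fixed and $Y=\tilde YA/\sqrt q$, $S=Y^\top Y$, $F$, $G$, $H$ are regarded as functions of $\tilde Y$ (the derivatives exist almost surely). *)

(* Defs.v *)
From HB Require Import structures.
From mathcomp Require Import all_boot all_order all_algebra.
From mathcomp Require Import all_classical all_reals all_analysis.

Set Implicit Arguments.
Unset Strict Implicit.
Unset Printing Implicit Defensive.

Import Order.TTheory GRing.Theory Num.Theory.
Import numFieldNormedType.Exports.

Local Open Scope classical_set_scope.
Local Open Scope ring_scope.

Definition measure_matrix_display : measure_display -> measure_display.
Proof. exact. Qed.

(* 'M[R]_(m, n) carries the product sigma-algebra, i.e. the one generated by
   the m * n entries (as the library does for tuples). *)
Section measurable_matrix.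
Context (R : realType) (m n : nat).

Let entries : 'I_m * 'I_n -> 'M[R]_(m, n) -> R := fun ij M => M ij.1 ij.2.

Definition mx_measurable : set (set 'M[R]_(m, n)) :=
  <<s \bigcup_ij preimage_set_system setT (entries ij) measurable >>.

Let mx_measurable0 : mx_measurable set0.
Proof. exact: sigma_algebra0. Qed.

Let mx_measurableC C : mx_measurable C -> mx_measurable (~` C).
Proof. exact: sigma_algebraC. Qed.

Let mx_measurable_bigcup (F : (set 'M[R]_(m, n))^nat) :
  (forall i, mx_measurable (F i)) -> mx_measurable (\bigcup_i F i).
Proof. exact: sigma_algebra_bigcup. Qed.

HB.instance Definition _ := @isMeasurable.Build
  (measure_matrix_display default_measure_display) 'M[R]_(m, n)
  mx_measurable mx_measurable0 mx_measurableC mx_measurable_bigcup.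

End measurable_matrix.

Section independence.
Context {R : realType} {d : measure_display} {T : measurableType d}.
Variable P : probability T R.

Definition mutually_independent (I : finType) (d' : measure_display)
    (T' : measurableType d') (x : I -> T -> T') : Prop :=
  forall (J : {set I}) (B : I -> set T'), (forall i, measurable (B i)) ->
    P (\bigcap_(i in [set` J]) (x i @^-1` B i)) =
    (\prod_(i in J) P (x i @^-1` B i))%E.

Definition independent (d1 d2 : measure_display) (T1 : measurableType d1)
    (T2 : measurableType d2) (x : T -> T1) (y : T -> T2) : Prop :=
  forall B C, measurable B -> measurable C ->
    P (x @^-1` B `&` y @^-1` C) = (P (x @^-1` B) * P (y @^-1` C))%E.

End independence.

Section positive_definite.
Context {R : realType} {p : nat}.

Definition posdefmx (M : 'M[R]_p) : Prop :=
  M^T = M /\ forall v : 'cV[R]_p, v != 0 -> 0 < (v^T *m M *m v) 0 0.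

Definition posdef_sqrt (M A : 'M[R]_p) : Prop := posdefmx A /\ A *m A = M.

End positive_definite.

Section multivariate_normal.
Context {R : realType} {d : measure_display} {T : measurableType d}.
Variable P : probability T R.

Definition std_normal_vector (p : nat) (z : T -> 'cV[R]_p) : Prop :=
  mutually_independent P (fun i w => z w i 0) /\
  forall i (B : set R), measurable B ->
    P ((fun w => z w i 0) @^-1` B) = normal_prob 0 1 B.

(* N_p(mu, Sigma) for a positive definite Sigma: x = mu + Sigma^(1/2) z with z
   a vector of i.i.d. standard normal variables. *)
Definition mvnormal (p : nat) (mu : 'cV[R]_p) (Sigma : 'M[R]_p)
    (x : T -> 'cV[R]_p) : Prop :=
  exists2 A, posdef_sqrt Sigma A &
    std_normal_vector (fun w => invmx A *m (x w - mu)).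

(* N_{p x q}(theta, Sigma (x) I_q) *)
Definition normal_columns (p q : nat) (theta : 'M[R]_(p, q)) (Sigma : 'M[R]_p)
    (X : T -> 'M[R]_(p, q)) : Prop :=
  mutually_independent P (fun j w => col j (X w)) /\
  forall j, mvnormal (col j theta) Sigma (fun w => col j (X w)).

(* N_{m x p}(0, I_m (x) Sigma) *)
Definition normal_rows (m p : nat) (Sigma : 'M[R]_p)
    (Y : T -> 'M[R]_(m, p)) : Prop :=
  mutually_independent P (fun a w => row a (Y w)) /\
  forall a, mvnormal 0 Sigma (fun w => (row a (Y w))^T).

End multivariate_normal.

Section moore_penrose.
Context {R : realType}.

Definition is_pinv (m n : nat) (M : 'M[R]_(m, n)) (N : 'M[R]_(n, m)) : Prop :=
  [/\ M *m N *m M = M, N *m M *m N = N,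
      (M *m N)^T = M *m N & (N *m M)^T = N *m M].

(* The default value 0 is never taken: see is_pinv_ex. *)
Definition pinv (m n : nat) (M : 'M[R]_(m, n)) : 'M[R]_(n, m) :=
  xget 0 (is_pinv M).

Lemma is_pinv_inj (m n : nat) (M : 'M[R]_(m, n)) N N' :
  is_pinv M N -> is_pinv M N' -> N = N'.
Proof.
move=> [a1 a2 a3 a4] [b1 b2 b3 b4].
have e1 : M *m N = M *m N'.
  have h : M *m N = (M *m N') *m (M *m N) by rewrite mulmxA b1.
  by rewrite -a3 h trmx_mul a3 b3 mulmxA a1.
have e2 : N *m M = N' *m M.
  have h : N *m M = (N *m M) *m (N' *m M).
    by rewrite -mulmxA [M *m (N' *m M)]mulmxA b1.
  by rewrite -a4 h trmx_mul a4 b4 -mulmxA [M *m (N *m M)]mulmxA a1.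
by rewrite -a2 e2 -mulmxA e1 mulmxA b2.
Qed.

Lemma gram_unit (m n : nat) (B : 'M[R]_(m, n)) :
  row_free B -> B *m B^T \in unitmx.
Proof.
move=> Bf; rewrite -row_free_unit -kermx_eq0; apply/rowV0P => v.
move/sub_kermxP; rewrite mulmxA => vB.
have : (v *m B) *m (v *m B)^T = 0 by rewrite trmx_mul !mulmxA vB mul0mx.
move=> /matrixP/(_ 0 0); rewrite !mxE => /eqP.
rewrite psumr_eq0 => [/allP h|i _]; last by rewrite !mxE -expr2 sqr_ge0.
have vB0 : v *m B = 0.
  apply/rowP => i; have := h i (mem_index_enum i).
  by rewrite implyTb !mxE mulf_eq0 orbb => /eqP.
by apply: (row_free_inj Bf); rewrite vB0 mul0mx.
Qed.

Lemma is_pinv_mul (m n k : nat) (C : 'M[R]_(m, k)) (B : 'M[R]_(k, n)) :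
  C^T *m C \in unitmx -> B *m B^T \in unitmx ->
  is_pinv (C *m B) (B^T *m invmx (B *m B^T) *m (invmx (C^T *m C) *m C^T)).
Proof.
move=> uC uB; set N := _ *m (_ *m C^T).
have sB : (invmx (B *m B^T))^T = invmx (B *m B^T).
  by rewrite trmx_inv trmx_mul trmxK.
have sC : (invmx (C^T *m C))^T = invmx (C^T *m C).
  by rewrite trmx_inv trmx_mul trmxK.
have MN : C *m B *m N = C *m (invmx (C^T *m C) *m C^T).
  rewrite /N -mulmxA [B *m (_ *m _)]mulmxA [B *m (_ *m _)]mulmxA.
  by rewrite mulmxV // mul1mx.
have NM : N *m (C *m B) = B^T *m invmx (B *m B^T) *m B.
  rewrite /N -mulmxA [invmx _ *m C^T *m (C *m B)]mulmxA.
  by rewrite -[invmx _ *m C^T *m C]mulmxA mulVmx // mul1mx.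
split.
- rewrite MN mulmxA -[C *m _ *m C]mulmxA -[invmx _ *m C^T *m C]mulmxA.
  by rewrite mulVmx // mulmx1.
- rewrite NM /N mulmxA [B^T *m _ *m B *m _]mulmxA.
  by rewrite -[_ *m B *m B^T]mulmxA -[_ *m (B *m B^T) *m _]mulmxA mulmxV // mulmx1.
- by rewrite MN !trmx_mul trmxK sC mulmxA.
- by rewrite NM !trmx_mul trmxK sB mulmxA.
Qed.

Lemma is_pinv_ex (m n : nat) (M : 'M[R]_(m, n)) : exists N, is_pinv M N.
Proof.
rewrite -(mulmx_base M); eexists; apply: is_pinv_mul.
  have := @gram_unit _ _ (col_base M)^T; rewrite trmxK; apply.
  by rewrite /row_free mxrank_tr; exact: col_base_full.
by apply: gram_unit; exact: row_base_free.
Qed.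

Lemma pinvP (m n : nat) (M : 'M[R]_(m, n)) : is_pinv M (pinv M).
Proof. by rewrite /pinv; have [N hN] := is_pinv_ex M; exact: xgetI hN. Qed.

End moore_penrose.

Section divergence.
Context {R : realType}.

(* 'D_v returns an unspecified value where the derivative does not exist; for
   YtH below this only concerns a null set of matrices. *)
Definition divergence (m p : nat) (f : 'M[R]_(m, p) -> 'M[R]_(m, p))
    (M : 'M[R]_(m, p)) : R :=
  \sum_a \sum_i 'D_(delta_mx a i) (fun N => f N a i) M.

Definition gram (m p : nat) (Y : 'M[R]_(m, p)) : 'M[R]_p := Y^T *m Y.

Definition stat_F (p q : nat) (X : 'M[R]_(p, q)) (S : 'M[R]_p) : R :=
  \tr (X^T *m pinv S *m X).

Definition mx_G (p q : nat) (r : R -> R) (X : 'M[R]_(p, q)) (S : 'M[R]_p) :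
    'M[R]_p :=
  let F := stat_F X S in
  (r F ^+ 2 / F ^+ 2) *: (pinv S *m X *m X^T *m pinv S *m S).

Definition mx_H (p q : nat) (r : R -> R) (A : 'M[R]_p) (X : 'M[R]_(p, q))
    (S : 'M[R]_p) : 'M[R]_p :=
  A *m mx_G r X S *m invmx A.

(* Yt stands for \tilde Y; whiten and unwhiten are the mutually inverse maps
   Y |-> \tilde Y = sqrt q Y A^-1 and \tilde Y |-> Y = \tilde Y A / sqrt q. *)
Definition whiten (q m p : nat) (A : 'M[R]_p) (Y : 'M[R]_(m, p)) :
    'M[R]_(m, p) :=
  Num.sqrt q%:R *: (Y *m invmx A).

Definition unwhiten (q m p : nat) (A : 'M[R]_p) (Yt : 'M[R]_(m, p)) :
    'M[R]_(m, p) :=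
  (Num.sqrt q%:R)^-1 *: (Yt *m A).

Definition YtH (m p q : nat) (r : R -> R) (A : 'M[R]_p) (X : 'M[R]_(p, q))
    (Yt : 'M[R]_(m, p)) : 'M[R]_(m, p) :=
  Yt *m mx_H r A X (gram (unwhiten q A Yt)).

End divergence.

(* Main.v *)
(* Let Z be the transpose of the Moore-Penrose inverse of Y, so that S^+ = Z^T Z
   and Y G = (r(F)^2 / F^2) Z X X^T Z^T Y.  The divergence is a trace, hence does
   not see the change of variables between Y and \tilde Y, and differentiating Z
   gives, wherever Y has full rank and F != 0,
     div = (|p - nq| - 1) r^2 / F + 4 (r^2 / F^3 - r r' / F^2) tr(K^2)
   with K = X^T S^+ X, so that 0 <= tr(K^2) <= F^2.  As |p - nq| > 1, this lies
   between c / F - C and C / F + C: the question is whether E[1/F] is finite.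
   Let k = min(nq, p) be the almost sure rank of S.  Y factors through a row
   basis U = V A^-1 where V depends only on S and has an identity block in k
   columns, so U X consists, conditionally on S and on the other entries of
   A^-1 (X - theta), of kq independent shifted standard normal entries.  F is
   comparable to |U X|^2: above with a factor depending only on S, and below with
   the integrable factor tr S if the k columns have maximal volume.  Summing
   4^l P(|U X| <= 2^-l) over the dyadic scales, with small-ball probabilities of
   order 2^(-lkq), shows that E[1/F] is finite exactly when kq > 2. *)

Require Import Defs.
From HB Require Import structures.
From mathcomp Require Import all_boot all_order all_algebra.
From mathcomp Require Import all_classical all_reals all_analysis.
From mathcomp Require Import perm measurable_realfun ring lra zify.

Set Implicit Arguments.
Unset Strict Implicit.
Unset Printing Implicit Defensive.

Import Order.TTheory GRing.Theory Num.Theory.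
Import numFieldNormedType.Exports.

Local Open Scope classical_set_scope.
Local Open Scope ring_scope.

(** Two obstacles shape the proof. [pinv] is obtained by choice and ['D_v] is unspecified where the
    derivative fails to exist, so neither 1/F nor the divergence is ever shown to be measurable:
    integrals are compared through measurable functions that dominate the integrand, or are
    dominated by it, almost everywhere. Moreover, the columns of maximal volume vary with the sample
    point, whereas the small-ball estimate needs a fixed choice f of columns. For finiteness one
    sums over all f, each with a weight that depends on S only and vanishes where the minor f is
    singular; three of the kq entries suffice, since 4^l 8^-l is summable. For divergence a single f
    with a weight of positive integral is enough: every scale then contributes at least a fixed
    positive amount, and the number of scales is arbitrary, so the weight needs no moment bound. *)

Local Notation pinv := Defs.pinv.

(** * Derivatives of matrix-valued functions *)

Section matrix_derivatives.
Context {R : realType}.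

(** Both difference quotients are the same function of [h]. Partial derivatives of matrix functions
    thus become derivatives along curves of one real variable. *)
Lemma is_derive_line {V W : normedModType R} (f : V -> W) (x v : V) (df : W) :
  is_derive (0 : R) 1 (fun h => f (h *: v + x)) df -> is_derive x v f df.
Proof.
move=> [df1 <-].
have dfx : derivable f x v by exact: (derivable1P _ _ _).2 df1.
apply: (DeriveDef dfx).
rewrite /derive; set g1 := fun h => h^-1 *: _; set g2 := fun h => h^-1 *: _.
suff -> : g1 = g2 by [].
by apply/funext => h; rewrite /g1 /g2 /= addr0 scale0r add0r [_%:A]mulr1.
Qed.

Lemma is_derive_mxP {m n : nat} (M : R -> 'M[R]_(m, n)) (x : R)
    (dM : 'M[R]_(m, n)) :
  (forall i j, is_derive x 1 (fun h => M h i j) (dM i j)) <->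
  is_derive x 1 M dM.
Proof.
split=> [dMij|[dMx <-] i j].
  have dMx : derivable M x 1 by apply/derivable_mxP => i j; case: (dMij i j).
  split=> //; rewrite derive_mx//; apply/matrixP => i j; rewrite mxE.
  by case: (dMij i j).
split; first by move/derivable_mxP : dMx; exact.
by rewrite derive_mx// mxE.
Qed.

Lemma is_derive_bigsum {I : Type} (s : seq I) (f : I -> R -> R) (df : I -> R)
    (x : R) :
  (forall i, is_derive x 1 (f i) (df i)) ->
  is_derive x 1 (fun h => \sum_(i <- s) f i h) (\sum_(i <- s) df i).
Proof.
move=> fdf; elim: s => [|i s ih].
  rewrite big_nil (_ : (fun _ => _) = cst 0); first exact: is_derive_cst.
  by apply/funext => h; rewrite big_nil.
rewrite big_cons (_ : (fun _ => _) = f i + (fun h => \sum_(i <- s) f i h)).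
  exact: is_deriveD.
by apply/funext => h; rewrite big_cons.
Qed.

Lemma is_derive_mul (f g : R -> R) (x df dg : R) :
  is_derive x 1 f df -> is_derive x 1 g dg ->
  is_derive x 1 (fun h => f h * g h) (df * g x + f x * dg).
Proof.
move=> dfx dgx; rewrite (_ : (fun _ => _) = f * g)//.
apply: (is_derive_eq (is_deriveM dfx dgx)).
by rewrite addrC; congr (_ + _); exact: mulrC.
Qed.

Lemma derivable_bigprod {I : Type} (s : seq I) (f : I -> R -> R) (x : R) :
  (forall i, derivable (f i) x 1) ->
  derivable (fun h => \prod_(i <- s) f i h) x 1.
Proof.
move=> df; elim: s => [|i s ih].
  rewrite (_ : (fun _ => _) = cst 1); first exact: derivable_cst.
  by apply/funext => h; rewrite big_nil.
rewrite (_ : (fun _ => _) = f i * (fun h => \prod_(i <- s) f i h)).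
  exact: derivableM.
by apply/funext => h; rewrite big_cons.
Qed.

Lemma is_derive_mulmx {m n k : nat} (M : R -> 'M[R]_(m, n))
    (N : R -> 'M[R]_(n, k)) (x : R) (dM : 'M[R]_(m, n))
    (dN : 'M[R]_(n, k)) :
  is_derive x 1 M dM -> is_derive x 1 N dN ->
  is_derive x 1 (fun h => M h *m N h) (dM *m N x + M x *m dN).
Proof.
move=> /is_derive_mxP dMx /is_derive_mxP dNx; apply/is_derive_mxP => i j.
rewrite (_ : (fun _ => _) = (fun h => \sum_l M h i l * N h l j)); last first.
  by apply/funext => h; rewrite mxE.
rewrite !mxE -big_split/=; apply: is_derive_bigsum => l.
exact: is_derive_mul.
Qed.

Lemma is_derive_trmx {m n : nat} (M : R -> 'M[R]_(m, n)) (x : R)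
    (dM : 'M[R]_(m, n)) :
  is_derive x 1 M dM -> is_derive x 1 (fun h => (M h)^T) dM^T.
Proof.
move=> /is_derive_mxP dMx; apply/is_derive_mxP => i j.
rewrite (_ : (fun _ => _) = (fun h => M h j i)); first by rewrite mxE.
by apply/funext => h; rewrite mxE.
Qed.

Lemma is_derive_mxtrace {n : nat} (M : R -> 'M[R]_n) (x : R) (dM : 'M[R]_n) :
  is_derive x 1 M dM -> is_derive x 1 (fun h => \tr (M h)) (\tr dM).
Proof. by move=> /is_derive_mxP dMx; apply: is_derive_bigsum => i. Qed.

Lemma is_derive_scalemx {m n : nat} (f : R -> R) (M : R -> 'M[R]_(m, n)) (x : R)
    (df : R) (dM : 'M[R]_(m, n)) :
  is_derive x 1 f df -> is_derive x 1 M dM ->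
  is_derive x 1 (fun h => f h *: M h) (df *: M x + f x *: dM).
Proof.
move=> dfx /is_derive_mxP dMx; apply/is_derive_mxP => i j.
rewrite (_ : (fun _ => _) = (fun h => f h * M h i j)); last first.
  by apply/funext => h; rewrite mxE.
by rewrite !mxE; exact: is_derive_mul.
Qed.

Lemma is_derive_affine {m n : nat} (D M : 'M[R]_(m, n)) (x : R) :
  is_derive x 1 (fun h : R => h *: D + M) D.
Proof.
apply/is_derive_mxP => i j.
rewrite (_ : (fun _ => _) = (fun h => h * D i j + M i j)); last first.
  by apply/funext => h; rewrite !mxE.
by apply: is_derive_eq; rewrite addr0 scaler0 add0r; exact: mulr1.
Qed.

Lemma derivable_det {n : nat} (M : R -> 'M[R]_n) (x : R) :
  derivable M x 1 -> derivable (fun h => \det (M h)) x 1.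
Proof.
move=> /derivable_mxP dM.
suff : is_derive x 1 (fun h => \det (M h))
    (\sum_(s : {perm 'I_n}) 'D_1 (fun h => (-1) ^+ s * \prod_i M h i (s i)) x).
  by case.
apply: is_derive_bigsum => s; apply: derivableP.
apply: derivableM; first exact: derivable_cst.
by apply: derivable_bigprod => i.
Qed.

Lemma near_unitmx {n : nat} (M : R -> 'M[R]_n) (x : R) :
  derivable M x 1 -> M x \in unitmx -> \forall h \near x, M h \in unitmx.
Proof.
move=> /derivable_det /derivable1_diffP /differentiable_continuous cdet.
rewrite unitmxE unitfE => det0.
apply: (filterS _ (cvgr_neq0 _ cdet det0)) => h.
by rewrite unitmxE unitfE.
Qed.

(** Near an invertible point [invmx] is the adjugate divided by the determinant, a rational function
    of the entries. *)
Lemma derivable_invmx {n : nat} (M : R -> 'M[R]_n) (x : R) :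
  derivable M x 1 -> M x \in unitmx -> derivable (fun h => invmx (M h)) x 1.
Proof.
move=> dM uM; apply: (@near_eq_derivable _ _ _
    (fun h => (\det (M h))^-1 *: \adj (M h))).
  near=> h; rewrite /invmx ifT//.
  by near: h; exact: near_unitmx.
apply/derivable_mxP => i j.
rewrite (_ : (fun _ => _) = (fun h => (\det (M h))^-1 * \adj (M h) i j)).
  2: by apply/funext => h; rewrite mxE.
apply: derivableM.
  apply: derivableV; last exact: derivable_det.
  by move: uM; rewrite unitmxE unitfE.
rewrite (_ : (fun _ => _) = (fun h => cofactor (M h) j i)).
  2: by apply/funext => h; rewrite mxE.
apply: derivableM; first exact: derivable_cst.
apply: derivable_det; apply/derivable_mxP => k l.
rewrite (_ : (fun _ => _) = (fun h => M h (lift j k) (lift i l))).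
  2: by apply/funext => h; rewrite !mxE.
by move/derivable_mxP : dM; exact.
Unshelve. all: by end_near. Qed.

(** Existence being known, the value comes from differentiating [M h *m invmx (M h)], which is
    constant near [x]. *)
Lemma is_derive_invmx {n : nat} (M : R -> 'M[R]_n) (x : R) (dM : 'M[R]_n) :
  is_derive x 1 M dM -> M x \in unitmx ->
  is_derive x 1 (fun h => invmx (M h))
    (- (invmx (M x) *m dM *m invmx (M x))).
Proof.
move=> dMx uM; have dM1 : derivable M x 1 by case: dMx.
have /derivableP di := derivable_invmx dM1 uM.
apply: (is_derive_eq di).
have [_ d1] := is_derive_mulmx dMx di.
have [_ d2] : is_derive x 1 (fun h => M h *m invmx (M h)) 0.
  apply: (near_eq_is_derive _ (is_derive_cst (1%:M : 'M[R]_n) x 1)).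
  near=> h; rewrite mulmxV//.
  by near: h; exact: near_unitmx.
have /(congr1 (mulmx (invmx (M x)))) := esym (etrans (esym d2) d1).
rewrite mulmx0 mulmxDr !mulmxA mulVmx// mul1mx => /eqP.
by rewrite addrC addr_eq0 => /eqP ->.
Unshelve. all: by end_near. Qed.

End matrix_derivatives.

(** * The Moore-Penrose inverse *)

(** The Z of the overview, of the same shape as [M]; locked so that rewriting does not see the
    transpose inside. *)
HB.lock Definition pinvT {R : realType} {m n : nat} (M : 'M[R]_(m, n)) :
  'M[R]_(m, n) := (pinv M)^T.

Section moore_penrose_identities.
Context {R : realType} {m n : nat}.
Implicit Type M : 'M[R]_(m, n).

Lemma pinv_tr M : pinv M^T = (pinv M)^T.
Proof.
apply: (is_pinv_inj (pinvP _)); have [h1 h2 h3 h4] := pinvP M; split.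
- by rewrite -!trmx_mul mulmxA h1.
- by rewrite -!trmx_mul mulmxA h2.
- by rewrite -trmx_mul h4.
- by rewrite -trmx_mul h3.
Qed.

Lemma trmx_pinvT M : (pinvT M)^T = pinv M.
Proof. by rewrite unlock trmxK. Qed.

Lemma pinvTK M : M *m (pinvT M)^T *m M = M.
Proof. by rewrite trmx_pinvT; have [] := pinvP M. Qed.

Lemma pinvTKV M : (pinvT M)^T *m M *m (pinvT M)^T = (pinvT M)^T.
Proof. by rewrite trmx_pinvT; have [] := pinvP M. Qed.

Lemma mul_pinvT_tr M : pinvT M *m M^T = M *m (pinvT M)^T.
Proof. by rewrite unlock trmxK -trmx_mul; have [] := pinvP M. Qed.

Lemma mul_tr_pinvT M : M^T *m pinvT M = (pinvT M)^T *m M.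
Proof. by rewrite unlock trmxK -trmx_mul; have [] := pinvP M. Qed.

Lemma pinvT_trmulK M : M *m ((pinvT M)^T *m pinvT M) = pinvT M.
Proof.
apply: trmx_inj; rewrite !trmx_mul trmxK -mulmxA mul_pinvT_tr mulmxA.
exact: pinvTKV.
Qed.

(** Both products of [gram M] with the right-hand side are the orthogonal projector [pinv M *m M],
    which gives the four Penrose equations. *)
Lemma pinv_gram M : pinv (gram M) = (pinvT M)^T *m pinvT M.
Proof.
have e1 : gram M *m ((pinvT M)^T *m pinvT M) = (pinvT M)^T *m M.
  by rewrite /gram -mulmxA pinvT_trmulK mul_tr_pinvT.
have e2 : (pinvT M)^T *m pinvT M *m gram M = (pinvT M)^T *m M.
  by rewrite /gram -mulmxA [pinvT M *m _]mulmxA mul_pinvT_tr pinvTK.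
apply: (is_pinv_inj (pinvP _)); split.
- rewrite e1 -mul_tr_pinvT /gram mulmxA -[_ *m _ *m M^T]mulmxA mul_pinvT_tr.
  by rewrite -!mulmxA [M *m (_ *m _)]mulmxA pinvTK.
- by rewrite e2 mulmxA pinvTKV.
- by rewrite e1 trmx_mul trmxK mul_tr_pinvT.
- by rewrite e2 trmx_mul trmxK mul_tr_pinvT.
Qed.

Lemma pinvT_row_free M : M *m M^T \in unitmx ->
  pinvT M = invmx (M *m M^T) *m M.
Proof.
move=> uM; apply: trmx_inj; rewrite trmx_pinvT.
apply: (is_pinv_inj (pinvP _)).
have := @is_pinv_mul R m n m 1%:M M; rewrite trmx1 !mul1mx unitmx1 invmx1.
by rewrite trmx_mul trmx_inv trmx_mul trmxK !mulmx1; apply.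
Qed.

End moore_penrose_identities.

Section moore_penrose_derivative.
Context {R : realType}.

(* Golub and Pereyra's differential of the Moore-Penrose inverse at constant
   rank; at full rank one of the last two terms vanishes. *)
Definition dpinvT {m n : nat} (Y Z D : 'M[R]_(m, n)) : 'M[R]_(m, n) :=
  - (Z *m D^T *m Z) + (1%:M - Y *m Z^T) *m D *m (Z^T *m Z) +
  Z *m Z^T *m D *m (1%:M - Z^T *m Y).

(** Here Z is [invmx (Y *m Y^T) *m Y], so that Y Z^T = 1, which kills the middle term of [dpinvT],
    and Z Z^T is the inverse of Y Y^T. *)
Lemma is_derive_pinvT_row_free {m n : nat} (Y : R -> 'M[R]_(m, n)) (x : R)
    (D : 'M[R]_(m, n)) :
  is_derive x 1 Y D -> Y x *m (Y x)^T \in unitmx ->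
  is_derive x 1 (fun h => pinvT (Y h)) (dpinvT (Y x) (pinvT (Y x)) D).
Proof.
move=> dY uY.
have dYY := is_derive_mulmx dY (is_derive_trmx dY).
apply: (@near_eq_is_derive _ _ _ (fun h => invmx (Y h *m (Y h)^T) *m Y h)).
  near=> h; rewrite pinvT_row_free//.
  by near: h; apply: near_unitmx => //; case: dYY.
apply: (is_derive_eq (is_derive_mulmx (is_derive_invmx dYY uY) dY)).
rewrite /dpinvT; set Z := pinvT (Y x).
have ZE : Z = invmx (Y x *m (Y x)^T) *m Y x by exact: pinvT_row_free.
have YZ : Y x *m Z^T = 1%:M.
  by rewrite -mul_pinvT_tr -/Z ZE -mulmxA mulVmx.
have ZZ : Z *m Z^T = invmx (Y x *m (Y x)^T) by rewrite {1}ZE -mulmxA YZ mulmx1.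
rewrite YZ subrr !mul0mx addr0 ZZ mulNmx mulmxBr mulmx1 -!mulmxA -ZE.
rewrite mulmxDl mulmxDr opprD !mulmxA -ZE -[_ *m Z^T *m _]mulmxA -mul_tr_pinvT.
by rewrite mulmxA [- (_ *m _ *m _) - _]addrC -addrA; congr (_ + _); rewrite addrC.
Unshelve. all: by end_near. Qed.

(** Transposition exchanges the last two terms of [dpinvT]; this reduces full column rank to full
    row rank. *)
Lemma tr_dpinvT {m n : nat} (Y : 'M[R]_(m, n)) (Z : 'M[R]_(n, m))
    (D : 'M[R]_(m, n)) :
  (dpinvT Y^T Z D^T)^T = dpinvT Y Z^T D.
Proof.
rewrite /dpinvT !trmxK 2!raddfD/= raddfN/= !trmx_mul !trmxK !mulmxA addrAC.
by congr (_ + _ + _); rewrite raddfB/= trmx1 trmx_mul !trmxK.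
Qed.

Lemma is_derive_pinvT {m n : nat} (Y : R -> 'M[R]_(m, n)) (x : R)
    (D : 'M[R]_(m, n)) :
  is_derive x 1 Y D ->
  (Y x)^T *m Y x \in unitmx \/ Y x *m (Y x)^T \in unitmx ->
  is_derive x 1 (fun h => pinvT (Y h)) (dpinvT (Y x) (pinvT (Y x)) D).
Proof.
move=> dY [uY|]; last exact: is_derive_pinvT_row_free.
have ptr h : pinvT (Y h) = (pinvT (Y h)^T)^T.
  by rewrite trmx_pinvT pinv_tr -trmx_pinvT trmxK.
rewrite (_ : (fun _ => _) = (fun h => (pinvT (Y h)^T)^T)); last first.
  by apply/funext.
have := @is_derive_pinvT_row_free _ _ _ _ _ (is_derive_trmx dY).
rewrite trmxK => /(_ uY) /is_derive_trmx dZ; apply: (is_derive_eq dZ).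
by rewrite (ptr x) tr_dpinvT.
Qed.

End moore_penrose_derivative.

(** * The divergence *)

Lemma mul_delta_entry {R : realType} {k l m p : nat} (P : 'M[R]_(k, m))
    (Q : 'M[R]_(p, l)) a i b j :
  (P *m delta_mx a i *m Q) b j = P b a * Q i j.
Proof.
rewrite !mxE (bigD1 i)//= big1 ?addr0 => [|i' i'i]; last first.
  by rewrite !mxE big1 ?mul0r// => a' _; rewrite !mxE (negbTE i'i) andbF mulr0.
rewrite !mxE (bigD1 a)//= big1 ?addr0 => [|a' a'a]; last first.
  by rewrite !mxE (negbTE a'a) mulr0.
by rewrite !mxE !eqxx mulr1.
Qed.

Section divergence_formula.
Context {R : realType} {m p : nat}.

(* [B] and [B'] stand for the changes of variables between [Y] and [\tilde Y];
   they disappear because the divergence is a trace. *)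
Definition lin_trace (B B' : 'M[R]_p) (L : 'M[R]_(m, p) -> 'M[R]_(m, p)) : R :=
  \sum_a \sum_i (L (delta_mx a i *m B) *m B') a i.

Lemma lin_traceD B B' L1 L2 : lin_trace B B' (fun D => L1 D + L2 D) =
  lin_trace B B' L1 + lin_trace B B' L2.
Proof.
rewrite /lin_trace -big_split; apply: eq_bigr => a _.
by rewrite -big_split; apply: eq_bigr => i _; rewrite mulmxDl mxE.
Qed.

Lemma lin_traceZ B B' k L :
  lin_trace B B' (fun D => k *: L D) = k * lin_trace B B' L.
Proof.
rewrite /lin_trace mulr_sumr; apply: eq_bigr => a _.
by rewrite mulr_sumr; apply: eq_bigr => i _; rewrite -scalemxAl mxE.
Qed.

Lemma lin_traceN B B' L : lin_trace B B' (fun D => - L D) = - lin_trace B B' L.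
Proof.
rewrite -mulN1r -lin_traceZ; congr lin_trace; apply/funext => D.
by rewrite scaleN1r.
Qed.

Variables B B' : 'M[R]_p.
Hypothesis BB' : B *m B' = 1%:M.

(** This and the next two lemmas cover every kind of term in the differential; each time [B] and
    [B'] meet inside a cyclic trace and cancel. *)
Lemma lin_trace_mul (P : 'M[R]_m) (Q : 'M[R]_p) :
  lin_trace B B' (fun D => P *m D *m Q) = \tr P * \tr Q.
Proof.
have -> : \tr Q = \tr (B *m Q *m B').
  by rewrite mxtrace_mulC mulmxA (mulmx1C BB') mul1mx.
rewrite /lin_trace /mxtrace mulr_suml; apply: eq_bigr => a _.
rewrite mulr_sumr; apply: eq_bigr => i _.
by rewrite mulmxA -2!mulmxA mul_delta_entry mulmxA.
Qed.

Lemma lin_trace_tr (P Q : 'M[R]_(m, p)) :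
  lin_trace B B' (fun D => P *m D^T *m Q) = \tr (P *m Q^T).
Proof.
have -> : P *m Q^T = (P *m B^T) *m (Q *m B')^T.
  by rewrite trmx_mul mulmxA -[P *m _ *m _]mulmxA -trmx_mul (mulmx1C BB')
    trmx1 mulmx1.
rewrite /lin_trace /mxtrace; apply: eq_bigr => a _.
rewrite [RHS]mxE; apply: eq_bigr => i _.
rewrite trmx_mul trmx_delta !mulmxA -[_ *m Q *m B']mulmxA mul_delta_entry.
by congr (_ * _); rewrite [RHS]mxE.
Qed.

Lemma lin_trace_scalar (K : 'M[R]_(p, m)) (V : 'M[R]_(m, p)) :
  lin_trace B B' (fun D => \tr (K *m D) *: V) = \tr (K *m V).
Proof.
have -> : \tr (K *m V) = \tr (B *m K *m (V *m B')).
  rewrite [RHS]mxtrace_mulC mulmxA -[V *m B' *m B]mulmxA (mulmx1C BB').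
  by rewrite mulmx1 mxtrace_mulC.
rewrite mxtrace_mulC /lin_trace /mxtrace; apply: eq_bigr => a _.
rewrite [RHS]mxE; apply: eq_bigr => i _.
rewrite -scalemxAl mxE mulrC; congr (_ * _).
rewrite -/(mxtrace _) mulmxA mxtrace_mulC mulmxA /mxtrace.
rewrite (bigD1 i)//= big1 ?addr0 => [|i' i'i]; last first.
  by rewrite -[_ *m delta_mx a i]mulmx1 mul_delta_entry [X in _ * X]mxE eq_sym
    (negbTE i'i) mulr0.
by rewrite -[_ *m delta_mx a i]mulmx1 mul_delta_entry [X in _ * X]mxE eqxx mulr1.
Qed.

End divergence_formula.

Section divergence_of_YtH.
Context {R : realType} {m p q : nat}.
Variables (r : R -> R) (X : 'M[R]_(p, q)).

Lemma pinv_gram_mul (Y : 'M[R]_(m, p)) :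
  pinv (gram Y) *m gram Y = (pinvT Y)^T *m Y.
Proof.
by rewrite pinv_gram /gram -mulmxA [pinvT Y *m _]mulmxA mul_pinvT_tr pinvTK.
Qed.

(** With M = Z X this is M M^T, while the matrix K of the overview is M^T M; traces of powers
    agree. *)
Definition stat_B (Y : 'M[R]_(m, p)) : 'M[R]_m :=
  pinvT Y *m (X *m X^T) *m (pinvT Y)^T.

Lemma stat_F_trB (Y : 'M[R]_(m, p)) : stat_F X (gram Y) = \tr (stat_B Y).
Proof.
rewrite /stat_F pinv_gram /stat_B mxtrace_mulC -[in RHS]mulmxA.
by rewrite [RHS]mxtrace_mulC !mulmxA.
Qed.

Definition phi (t : R) : R := r t ^+ 2 / t ^+ 2.

(** Uses Y S^+ = Z and S^+ S = Z^T Y. *)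
Lemma mul_mx_G (Y : 'M[R]_(m, p)) :
  Y *m mx_G r X (gram Y) =
  phi (\tr (stat_B Y)) *: (pinvT Y *m (X *m X^T) *m ((pinvT Y)^T *m Y)).
Proof.
rewrite /mx_G stat_F_trB -/(phi _) -scalemxAr; congr (_ *: _).
rewrite -[_ *m pinv _ *m gram Y]mulmxA pinv_gram_mul pinv_gram !mulmxA.
by rewrite -[Y *m _ *m pinvT Y]mulmxA pinvT_trmulK.
Qed.

Lemma is_derive_phi (t : R) : derivable r t 1 -> t != 0 ->
  is_derive t 1 phi (2 * r t * r^`()%classic t / t ^+ 2 - 2 * r t ^+ 2 / t ^+ 3).
Proof.
move=> /derivableP dr t0.
have d1 := is_derive_mul dr dr.
have d2 := is_derive_mul (is_derive_id t 1) (is_derive_id t 1).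
have tt0 : t * t != 0 by rewrite mulf_neq0.
have d3 := is_derive_mul d1 (@is_deriveV _ (fun h : R => h * h) _ _ _ tt0 d2).
rewrite (_ : phi = (fun h => r h * r h * (h * h)^-1)); last first.
  by apply/funext => h; rewrite /phi !expr2.
apply: (is_derive_eq d3); by rewrite derive1E /GRing.scale/=; field.
Qed.

End divergence_of_YtH.

Section divergence_algebra.
Context {R : realType} {m p : nat}.
Variables (Y Z : 'M[R]_(m, p)) (C : 'M[R]_p).
Hypotheses (YZY : Y *m Z^T *m Y = Y) (ZYZ : Z^T *m Y *m Z^T = Z^T).
Hypotheses (ZY : Z *m Y^T = Y *m Z^T) (YZ : Y^T *m Z = Z^T *m Y).
Hypothesis trC : C^T = C.
Let rho := \tr (Z^T *m Y).

Let ZYtr : (Z^T *m Y)^T = Z^T *m Y.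
Proof. by rewrite trmx_mul trmxK YZ. Qed.

Let YZtr : (Y *m Z^T)^T = Y *m Z^T.
Proof. by rewrite trmx_mul trmxK ZY. Qed.

Let ZZY : Z *m Z^T *m Y = Z.
Proof.
by apply: trmx_inj; rewrite -mulmxA !trmx_mul trmxK YZ ZYZ.
Qed.

(** Product rule for Z C Z^T Y in the direction [D], with C = X X^T in the application; [dF] below
    is likewise the differential of tr(Z C Z^T). *)
Definition dmain (D : 'M[R]_(m, p)) : 'M[R]_(m, p) :=
  dpinvT Y Z D *m C *m (Z^T *m Y) +
  Z *m C *m ((dpinvT Y Z D)^T *m Y + Z^T *m D).

Definition dF (D : 'M[R]_(m, p)) : R :=
  \tr (dpinvT Y Z D *m C *m Z^T + Z *m C *m (dpinvT Y Z D)^T).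

Variables B B' : 'M[R]_p.
Hypothesis BB' : B *m B' = 1%:M.

(** Of the seven terms, three vanish because a projector meets its complement. The others contribute
    -1, m - rho, -rho and p times tr(Z C Z^T). *)
Lemma lin_trace_dmain : lin_trace B B' dmain =
  (m%:R + p%:R - 1 - 2 * rho) * \tr (Z *m C *m Z^T).
Proof.
pose Q := C *m (Z^T *m Y).
have trYZ : \tr (Y *m Z^T) = rho by rewrite mxtrace_mulC.
rewrite (_ : dmain = fun D =>
    - (Z *m D^T *m (Z *m Q)) + (1%:M - Y *m Z^T) *m D *m (Z^T *m Z *m Q) +
    Z *m Z^T *m D *m ((1%:M - Z^T *m Y) *m Q) +
    (- ((Z *m C *m Z^T) *m D *m (Z^T *m Y)) +
    (Z *m C *m (Z^T *m Z)) *m D^T *m ((1%:M - Y *m Z^T) *m Y) +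
    (Z *m C *m (1%:M - Z^T *m Y)) *m D^T *m (Z *m Z^T *m Y) +
    (Z *m C *m Z^T) *m D *m 1%:M)); last first.
  have tr1 : (1%:M - Y *m Z^T)^T = 1%:M - Y *m Z^T by rewrite raddfB/= trmx1 YZtr.
  have tr2 : (1%:M - Z^T *m Y)^T = 1%:M - Z^T *m Y by rewrite raddfB/= trmx1 ZYtr.
  apply/funext => D; rewrite /dmain /dpinvT /Q.
  move: (1%:M - Y *m Z^T) (1%:M - Z^T *m Y) tr1 tr2 => I1 I2 tr1 tr2.
  congr (_ + _).
    by rewrite !mulmxDl !mulNmx !mulmxA.
  rewrite mulmxDr mulmx1 [Z *m C *m (Z^T *m D)]mulmxA; congr (_ + _).
  rewrite !raddfD/= raddfN/= !trmx_mul !trmxK.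
  by rewrite tr1 tr2 !mulmxDl !mulNmx !mulmxDr mulmxN !mulmxA.
rewrite !(lin_traceD, lin_traceN) !(lin_trace_mul BB') !(lin_trace_tr BB').
rewrite [(_ - Y *m _) *m Y]mulmxBl mul1mx YZY subrr trmx0 mulmx0 mxtrace0 addr0.
have -> : \tr ((1%:M - Z^T *m Y) *m Q) = 0.
  by rewrite mxtrace_mulC /Q -mulmxA mulmxBr mulmx1 mulmxA ZYZ subrr
    mulmx0 mxtrace0.
have -> : \tr (Z *m C *m (1%:M - Z^T *m Y) *m (Z *m Z^T *m Y)^T) = 0.
  rewrite ZZY -mulmxA mulmxBl mul1mx.
  by rewrite ZYZ subrr mulmx0 mxtrace0.
have -> : \tr (Z *m (Z *m Q)^T) = \tr (Z *m C *m Z^T).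
  by rewrite trmx_mul [Q^T]trmx_mul trC ZYtr !mulmxA ZZY.
have -> : \tr (Z^T *m Z *m Q) = \tr (Z *m C *m Z^T).
  rewrite /Q mxtrace_mulC !mulmxA -2![C *m _ *m _]mulmxA.
  by rewrite [_ *m Y *m Z^T]ZYZ mxtrace_mulC mulmxA.
rewrite raddfB/= !mxtrace1 trYZ -/rho.
ring.
Qed.

(** Puts the differential of F in the form [\tr (K *m D)] that [lin_trace_scalar] asks for. *)
Lemma dF_trace : dF = fun D =>
  \tr ((2 *: ((1%:M - Z^T *m Y) *m C *m Z^T *m (Z *m Z^T) -
       Z^T *m (Z *m C *m Z^T))) *m D).
Proof.
apply/funext => D; rewrite /dF raddfD/=.
have -> : \tr (Z *m C *m (dpinvT Y Z D)^T) = \tr (dpinvT Y Z D *m C *m Z^T).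
  by rewrite -mxtrace_tr !trmx_mul trmxK trC mulmxA.
rewrite -scalemxAl linearZ/= mulr_natl mulr2n.
set K := (K in \tr (K *m D)).
suff -> : \tr (dpinvT Y Z D *m C *m Z^T) = \tr (K *m D) by [].
have ZI1 : Z^T *m (1%:M - Y *m Z^T) = 0.
  by rewrite mulmxBr mulmx1 mulmxA ZYZ subrr.
rewrite /K /dpinvT.
move: (1%:M - Y *m Z^T) (1%:M - Z^T *m Y) ZI1 => I1 I2 ZI1.
rewrite !mulmxDl !raddfD/= !mulNmx !raddfN/=.
have -> : \tr (I1 *m D *m (Z^T *m Z) *m C *m Z^T) = 0.
  by rewrite mxtrace_mulC !mulmxA ZI1 !mul0mx mxtrace0.
rewrite addr0 addrC; congr (_ - _).
  transitivity (\tr ((Z *m Z^T *m D) *m (I2 *m C *m Z^T))).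
    by rewrite !mulmxA.
  by rewrite mxtrace_mulC !mulmxA.
rewrite -mxtrace_tr !trmx_mul !trmxK trC !mulmxA.
by rewrite [LHS]mxtrace_mulC !mulmxA.
Qed.

(** The first half of the kernel found in [dF_trace] drops out, since Y (1 - Z^T Y) = 0. *)
Lemma lin_trace_dF :
  lin_trace B B' (fun D => dF D *: (Z *m C *m (Z^T *m Y))) =
  - 2 * \tr (Z *m C *m Z^T *m (Z *m C *m Z^T)).
Proof.
rewrite dF_trace (lin_trace_scalar BB') -scalemxAl linearZ/= mulNr -mulrN.
congr (_ * _); rewrite mulmxBl raddfB/=.
have -> : \tr ((1%:M - Z^T *m Y) *m C *m Z^T *m (Z *m Z^T) *m
    (Z *m C *m (Z^T *m Y))) = 0.
  have YI2 : Y *m (1%:M - Z^T *m Y) = 0.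
    by rewrite mulmxBr mulmx1 mulmxA YZY subrr.
  by rewrite mxtrace_mulC !mulmxA -[_ *m Y *m (_ - _)]mulmxA YI2 mulmx0 !mul0mx
    mxtrace0.
rewrite sub0r; congr (- _).
rewrite [LHS]mxtrace_mulC !mulmxA -[_ *m Z^T *m Y]mulmxA.
by rewrite -[_ *m (Z^T *m Y) *m Z^T]mulmxA ZYZ.
Qed.

End divergence_algebra.

Section divergence_formula_YtH.
Context {R : realType} {m p q : nat}.
Variables (r : R -> R) (A : 'M[R]_p) (X : 'M[R]_(p, q)).
Hypotheses (q_gt0 : (0 < q)%N) (uA : A \in unitmx).

Let c := Num.sqrt (q%:R : R).
Let c_neq0 : c != 0.
Proof. by rewrite gt_eqF// sqrtr_gt0 ltr0n. Qed.
Let B := c^-1 *: A.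
Let B' := c *: invmx A.
Let BB' : B *m B' = 1%:M.
Proof.
by rewrite -scalemxAl -scalemxAr scalerA mulVf// scale1r mulmxV.
Qed.

Lemma YtHE (N : 'M[R]_(m, p)) : YtH r A X N =
  phi r (\tr (stat_B X (N *m B))) *:
    (pinvT (N *m B) *m (X *m X^T) *m ((pinvT (N *m B))^T *m (N *m B))) *m B'.
Proof.
rewrite /YtH /mx_H.
have -> : unwhiten q A N = N *m B by rewrite /unwhiten /B scalemxAr.
rewrite -mul_mx_G; have NA : N *m A = c *: (N *m B).
  by rewrite -scalemxAr scalerA divff// scale1r.
rewrite !mulmxA NA; move: (mx_G _ _ _) => G.
move: (N *m B) => M; by rewrite -!scalemxAl /B' -scalemxAr.
Qed.

Lemma is_derive_YtH (Y : 'M[R]_(m, p)) (D : 'M[R]_(m, p)) a i :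
  Y^T *m Y \in unitmx \/ Y *m Y^T \in unitmx ->
  let F := \tr (stat_B X Y) in
  let Z := pinvT Y in
  let C := X *m X^T in
  F != 0 -> derivable r F 1 ->
  is_derive (Y *m B') D (fun N => YtH r A X N a i)
    (((('D_1 (phi r) F * dF Y Z C (D *m B)) *: (Z *m C *m (Z^T *m Y)) +
    phi r F *: dmain Y Z C (D *m B)) *m B') a i).
Proof.
move=> uY F Z C F0 dr; apply: is_derive_line.
pose L (h : R) := h *: (D *m B) + Y.
have LE h : (h *: D + Y *m B') *m B = L h.
  by rewrite mulmxDl -mulmxA (mulmx1C BB') mulmx1 -scalemxAl.
have L0 : L 0 = Y by rewrite /L scale0r add0r.
have dL : is_derive (0 : R) 1 L (D *m B) by exact: is_derive_affine.
have dZ : is_derive (0 : R) 1 (fun h => pinvT (L h)) (dpinvT Y Z (D *m B)).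
  by have := is_derive_pinvT dL; rewrite L0; apply.
have dC : is_derive (0 : R) 1 (cst C) 0 by exact: is_derive_cst.
have dZC := is_derive_mulmx dZ dC.
have dZt := is_derive_trmx dZ.
have dB := is_derive_mulmx dZC dZt.
have dtr := is_derive_mxtrace dB.
have dphi : is_derive (0 : R) 1 (fun h => phi r (\tr (stat_B X (L h))))
    ('D_1 (phi r) F * dF Y Z C (D *m B)).
  have d1 : is_derive (\tr (stat_B X (L 0))) 1 (phi r) ('D_1 (phi r) F).
    by rewrite L0; apply: derivableP; case: (is_derive_phi dr F0).
  apply: (is_derive_eq (is_derive1_comp d1 dtr)).
  by rewrite L0 mulmx0 addr0.
have dV := is_derive_mulmx dZC (is_derive_mulmx dZt dL).
have dW := is_derive_scalemx dphi dV.
have dB' : is_derive (0 : R) 1 (cst B') 0 by exact: is_derive_cst.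
have /is_derive_mxP/(_ a i) dWB := is_derive_mulmx dW dB'.
rewrite (_ : (fun _ => _) = (fun h => (phi r (\tr (stat_B X (L h))) *:
    (pinvT (L h) *m C *m ((pinvT (L h))^T *m L h)) *m B') a i)); last first.
  by apply/funext => h; rewrite YtHE LE.
apply: (is_derive_eq dWB).
by rewrite !L0 !mulmx0 !addr0.
Qed.

Lemma divergence_YtH (Y : 'M[R]_(m, p)) :
  Y^T *m Y \in unitmx \/ Y *m Y^T \in unitmx ->
  let F := stat_F X (gram Y) in
  F != 0 -> derivable r F 1 ->
  divergence (YtH r A X) (whiten q A Y) =
  (m%:R + p%:R - 1 - 2 * \tr ((pinvT Y)^T *m Y)) * (r F ^+ 2 / F) +
  4 * (r F ^+ 2 / F ^+ 3 - r F * r^`()%classic F / F ^+ 2) *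
    \tr (stat_B X Y *m stat_B X Y).
Proof.
move=> uY F F0 dr; rewrite /F stat_F_trB in F0 dr *.
have -> : whiten q A Y = Y *m B' by rewrite /whiten /B' scalemxAr.
pose Z := pinvT Y; pose C := X *m X^T; set t := \tr (stat_B X Y) in F0 dr *.
have trC : C^T = C by rewrite trmx_mul trmxK.
have id1 := pinvTK Y; have id2 := pinvTKV Y.
have id3 := mul_pinvT_tr Y; have id4 := mul_tr_pinvT Y.
transitivity (lin_trace B B' (fun D =>
    'D_1 (phi r) t *: (dF Y Z C D *: (Z *m C *m (Z^T *m Y))) +
    phi r t *: dmain Y Z C D)).
  apply: eq_bigr => a _; apply: eq_bigr => i _.
  have [_ ->] := is_derive_YtH (delta_mx a i) a i uY F0 dr.
  by rewrite scalerA.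
rewrite lin_traceD !lin_traceZ (lin_trace_dF id1 id2 trC BB').
rewrite (lin_trace_dmain id1 id2 id3 id4 trC BB').
rewrite -[\tr (Z *m C *m Z^T)]/t -[Z *m C *m Z^T]/(stat_B X Y).
have [_ ->] := is_derive_phi dr F0; rewrite /phi -/Z.
by field.
Qed.

End divergence_formula_YtH.

(** * Matrix inequalities *)

Section frobenius.
Context {R : realType}.

Definition fnorm2 {m n : nat} (M : 'M[R]_(m, n)) : R :=
  \sum_i \sum_j M i j ^+ 2.

Lemma fnorm2_ge0 {m n : nat} (M : 'M[R]_(m, n)) : 0 <= fnorm2 M.
Proof. by apply: sumr_ge0 => i _; apply: sumr_ge0 => j _; exact: sqr_ge0. Qed.

Lemma fnorm2_trace {m n : nat} (M : 'M[R]_(m, n)) : fnorm2 M = \tr (M *m M^T).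
Proof.
apply: eq_bigr => i _; rewrite mxE; apply: eq_bigr => j _.
by rewrite mxE expr2.
Qed.

Lemma fnorm2_tr {m n : nat} (M : 'M[R]_(m, n)) : fnorm2 M^T = fnorm2 M.
Proof. by rewrite !fnorm2_trace trmxK mxtrace_mulC. Qed.

(** Lagrange's identity: twice the defect is a double sum of squares. *)
Lemma cauchy_schwarz_sum {n : nat} (u v : 'I_n -> R) :
  (\sum_k u k * v k) ^+ 2 <= (\sum_k u k ^+ 2) * (\sum_k v k ^+ 2).
Proof.
rewrite -subr_ge0 -(pmulr_rge0 _ (@ltr0n R 2)).
suff -> : 2 * ((\sum_k u k ^+ 2) * (\sum_k v k ^+ 2) -
    (\sum_k u k * v k) ^+ 2) =
    \sum_k \sum_l (u k * v l - u l * v k) ^+ 2.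
  by apply: sumr_ge0 => k _; apply: sumr_ge0 => l _; exact: sqr_ge0.
have dbl (f g : 'I_n -> R) :
    (\sum_k f k) * (\sum_k g k) = \sum_k \sum_l f k * g l.
  by rewrite mulr_suml; apply: eq_bigr => k _; rewrite mulr_sumr.
rewrite expr2 !dbl mulrBr !mulr_natl !mulr2n {2}exchange_big/= -!big_split/=.
rewrite -sumrB; apply: eq_bigr => k _; rewrite -!big_split/= -sumrB.
by apply: eq_bigr => l _; ring.
Qed.

Lemma fnorm2_mul {m n p : nat} (M : 'M[R]_(m, n)) (N : 'M[R]_(n, p)) :
  fnorm2 (M *m N) <= fnorm2 M * fnorm2 N.
Proof.
rewrite [fnorm2 N]exchange_big /fnorm2 mulr_suml; apply: ler_sum => i _.
rewrite mulr_sumr; apply: ler_sum => j _; rewrite mxE.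
exact: cauchy_schwarz_sum.
Qed.

End frobenius.

Section divergence_bounds.
Context {R : realType} {m p q : nat}.

Lemma full_rank_unit (Y : 'M[R]_(m, p)) : \rank Y = minn m p ->
  Y^T *m Y \in unitmx \/ Y *m Y^T \in unitmx.
Proof.
case: (leqP m p) => [mp rY|/ltnW pm rY].
  by right; apply: gram_unit; rewrite /row_free rY.
left; have := @gram_unit R _ _ Y^T; rewrite trmxK; apply.
by rewrite /row_free mxrank_tr rY.
Qed.

Lemma trace_pinvT (Y : 'M[R]_(m, p)) : \rank Y = minn m p ->
  \tr ((pinvT Y)^T *m Y) = (minn m p)%:R.
Proof.
case: (leqP m p) => [mp rY|/ltnW pm rY].
  have uY : Y *m Y^T \in unitmx by apply: gram_unit; rewrite /row_free rY.
  rewrite mxtrace_mulC -mul_pinvT_tr pinvT_row_free// -mulmxA mulVmx//.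
  by rewrite mxtrace1.
have uY : Y^T *m Y \in unitmx.
  have := @gram_unit R _ _ Y^T; rewrite trmxK; apply.
  by rewrite /row_free mxrank_tr rY.
suff -> : (pinvT Y)^T *m Y = 1%:M by rewrite mxtrace1.
apply: (can_inj (mulKmx uY)).
by rewrite mulmx1 -mulmxA [Y *m (_ *m _)]mulmxA pinvTK.
Qed.

Variable X : 'M[R]_(p, q).

Lemma stat_B_gram (Y : 'M[R]_(m, p)) :
  stat_B X Y = (pinvT Y *m X) *m (pinvT Y *m X)^T.
Proof. by rewrite trmx_mul /stat_B !mulmxA. Qed.

Lemma stat_F_fnorm2 (Y : 'M[R]_(m, p)) :
  stat_F X (gram Y) = fnorm2 (pinvT Y *m X).
Proof. by rewrite stat_F_trB stat_B_gram fnorm2_trace. Qed.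

(** As [stat_B] is symmetric, the trace of its square is its squared Frobenius norm, which is
    submultiplicative along [stat_B_gram]. *)
Lemma trace_stat_B2 (Y : 'M[R]_(m, p)) :
  0 <= \tr (stat_B X Y *m stat_B X Y) <= stat_F X (gram Y) ^+ 2.
Proof.
have Bsym : (stat_B X Y)^T = stat_B X Y.
  by rewrite stat_B_gram trmx_mul trmxK.
rewrite -{2 4}Bsym -fnorm2_trace fnorm2_ge0 stat_F_fnorm2/= stat_B_gram expr2.
by rewrite (le_trans (fnorm2_mul _ _))// fnorm2_tr.
Qed.

End divergence_bounds.

Section divergence_estimates.
Context {R : realType} {m p q : nat}.
Variables (r : R -> R) (c1 c2 cstar : R) (A : 'M[R]_p) (X : 'M[R]_(p, q)).
Hypotheses (q_gt0 : (0 < q)%N) (uA : A \in unitmx).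
Hypotheses (r_bounded : forall t : R, 0 <= r t <= c1).
Hypotheses (r_derivable : forall t : R, derivable r t 1).
Hypothesis (dr_bounded : forall t : R, `|r^`()%classic t| <= c2).
Hypothesis (cstar_gt0 : 0 < cstar).
Hypothesis r_ge_cstar : forall t : R, 0 <= t -> cstar <= r t <= c1.
Hypothesis pm1 : 1 < `|p%:Z - m%:Z|.

(** A natural number, at least 1 by [pm1]: this makes the r^2 / F term of the divergence strictly
    positive. *)
Let dim_factor : (m%:R + p%:R - 1 - 2 * (minn m p)%:R : R) =
  (`|(p : int) - (m : int)|%N - 1)%N%:R.
Proof.
have d1 : (1 <= `|(p : int) - (m : int)|)%N by move: pm1; lia.
rewrite natrB//; case: (leqP m p) => [mp|/ltnW pm].
  by rewrite distnEl// natrB//; ring.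
by rewrite distnEr// natrB//; ring.
Qed.

Lemma divergence_bounds (Y : 'M[R]_(m, p)) : \rank Y = minn m p ->
  let F := stat_F X (gram Y) in
  F != 0 ->
  cstar ^+ 2 / F - 4 * c1 * c2 <=
    `|divergence (YtH r A X) (whiten q A Y)| <=
  ((m + p)%:R + 4) * c1 ^+ 2 / F + 4 * c1 * c2.
Proof.
move=> rY F F0; rewrite (divergence_YtH q_gt0 uA (full_rank_unit rY) F0)//.
rewrite trace_pinvT// dim_factor -/F.
have /andP[] := trace_stat_B2 X Y; rewrite -/F.
set tau := \tr _; move=> tau0 tauF.
have F_gt0 : 0 < F by rewrite lt0r F0 /F stat_F_fnorm2 fnorm2_ge0.
set k := (_ - 1)%N; have k1 : (1 <= k)%N by move: pm1; lia.
have kmp : (k <= m + p)%N.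
  by rewrite /k; lia.
have /andP[rc rc1] := r_ge_cstar (ltW F_gt0).
have := dr_bounded F; set r' := r^`()%classic F => r'c2.
(* Normalized by F^2, the trace lies in [0, 1]. The r^2 terms are then of exact order 1/F, and the r
   r' term is bounded by [4 * c1 * c2]. *)
have -> : k%:R * (r F ^+ 2 / F) +
    4 * (r F ^+ 2 / F ^+ 3 - r F * r' / F ^+ 2) * tau =
    (k%:R + 4 * (tau / F ^+ 2)) * (r F ^+ 2 / F) -
    4 * (r F * r') * (tau / F ^+ 2).
  by field.
have F2 : 0 < F ^+ 2 by rewrite exprn_gt0.
have s0 : 0 <= tau / F ^+ 2 by rewrite divr_ge0// ltW.
have s1 : tau / F ^+ 2 <= 1 by rewrite ler_pdivrMr// mul1r.
move: (tau / F ^+ 2) s0 s1 => s s0 s1.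
have c1_ge0 : 0 <= c1 by have /andP[a b] := r_bounded 0; exact: le_trans b.
have c2_ge0 : 0 <= c2 by exact: le_trans (normr_ge0 _) r'c2.
have rF0 : 0 <= r F by exact: le_trans (ltW cstar_gt0) rc.
have e1 : `|4 * (r F * r') * s| <= 4 * c1 * c2.
  rewrite !normrM (ger0_norm s0) (ger0_norm rF0) normr_nat -[leRHS]mulr1.
  rewrite ler_pM ?mulr_ge0// -mulrA ler_wpM2l// ler_pM//.
have u1 : cstar ^+ 2 / F <= r F ^+ 2 / F.
  by rewrite ler_wpM2r ?invr_ge0 ?(ltW F_gt0)// lerXn2r// nnegrE ltW.
have u2 : r F ^+ 2 / F <= c1 ^+ 2 / F.
  by rewrite ler_wpM2r ?invr_ge0 ?(ltW F_gt0)// lerXn2r.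
have u0 : 0 <= cstar ^+ 2 / F by rewrite divr_ge0 ?ltW// exprn_gt0.
have u01 := le_trans u0 u1.
have k1R : 1 <= k%:R :> R by rewrite (ler_nat R 1).
have ks0 : 0 <= k%:R + 4 * s by rewrite addr_ge0// mulr_ge0.
have kmpR : k%:R <= (m + p)%:R :> R by rewrite ler_nat.
apply/andP; split.
  rewrite lerBlDr (le_trans u1)//.
  rewrite -[leLHS]mul1r (@le_trans _ _ ((k%:R + 4 * s) * (r F ^+ 2 / F)))//.
    rewrite ler_wpM2r//.
    by rewrite (le_trans k1R)// lerDl mulr_ge0.
  rewrite -[leLHS](subrK (4 * (r F * r') * s)) lerD// ?ler_norm//.
  exact: le_trans (ler_norm _) e1.
rewrite (le_trans (ler_normB _ _))// lerD// ger0_norm; last first.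
  exact: mulr_ge0.
rewrite -mulrA ler_pM//.
by rewrite lerD// -[leRHS]mulr1 ler_wpM2l.
Qed.

End divergence_estimates.

(** * Factorization through columns of maximal volume *)

Section column_factorization.
Context {R : realType}.

(* Agrees with [invmx] on invertible matrices and is visibly measurable. *)
Definition adjinv {n : nat} (M : 'M[R]_n) : 'M[R]_n := (\det M)^-1 *: \adj M.

Lemma adjinvE {n : nat} (M : 'M[R]_n) : M \in unitmx -> adjinv M = invmx M.
Proof. by rewrite /invmx => ->. Qed.

Lemma row_full_gram_unit {m n : nat} (N : 'M[R]_(m, n)) :
  \rank N = n -> N^T *m N \in unitmx.
Proof.
move=> rN; have := @gram_unit R _ _ N^T; rewrite trmxK; apply.
by rewrite /row_free mxrank_tr rN.
Qed.

Lemma rank_factorization {m n k : nat} (N : 'M[R]_(m, n)) : \rank N = k ->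
  exists (Q : 'M[R]_(m, k)) (N0 : 'M[R]_(k, n)),
    [/\ N = Q *m N0, row_free N0 & Q^T *m Q \in unitmx].
Proof.
move=> <-; exists (col_base N), (row_base N); split.
- by rewrite mulmx_base.
- exact: row_base_free.
- apply: row_full_gram_unit; apply/eqP; exact: col_base_full.
Qed.

Lemma colsub_unit_ex {k n : nat} (N : 'M[R]_(k, n)) : row_free N ->
  exists f : {ffun 'I_k -> 'I_n}, colsub f N \in unitmx.
Proof.
move=> fN; have fT : row_full N^T by rewrite /row_full mxrank_tr.
exists (fullrankfun fT).
by rewrite -unitmx_tr trmx_mxsub; exact: fullrowsub_unit.
Qed.

(** Cramer's rule for the identity matrix with column [i] replaced: expanding along row [i], only
    the diagonal term survives. *)
Lemma det_subst_col1 {k : nat} (M : 'M[R]_k) (i : 'I_k) :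
  (forall j l, l != i -> M j l = (j == l)%:R) -> \det M = M i i.
Proof.
move=> Mi; rewrite (expand_det_row _ i) (bigD1 i)//= big1 ?addr0 => [|l li].
  rewrite /cofactor addnn -signr_odd odd_double expr0 mul1r.
  rewrite (_ : row' i (col' i M) = 1%:M) ?det1 ?mulr1//.
  apply/matrixP => a b; rewrite !mxE Mi; last by rewrite eq_sym neq_lift.
  by rewrite (inj_eq lift_inj).
by rewrite Mi// eq_sym (negbTE li) mul0r.
Qed.

(* Choosing the columns of largest volume, Cramer's rule expresses every other
   column with coefficients at most 1. *)
Lemma max_volume {k n : nat} (N : 'M[R]_(k, n)) : row_free N ->
  exists f : {ffun 'I_k -> 'I_n}, colsub f N \in unitmx /\
    forall i j, `|(invmx (colsub f N) *m N) i j| <= 1.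
Proof.
move=> /colsub_unit_ex[f0 uf0].
pose vol (f : {ffun 'I_k -> 'I_n}) := `|\det (colsub f N)|.
have [f _ fmax] := @arg_maxP _ _ _ f0 xpredT vol isT.
have uf : colsub f N \in unitmx.
  rewrite unitmxE unitfE -normr_gt0; apply: lt_le_trans (fmax f0 isT).
  by rewrite /vol normr_gt0 -unitfE -unitmxE.
exists f; split=> // i j; set V := invmx _ *m N.
have NV : N = colsub f N *m V by rewrite mulKVmx.
pose f' : {ffun 'I_k -> 'I_n} := [ffun l => if l == i then j else f l].
have Nf' : colsub f' N = colsub f N *m colsub f' V by rewrite mulmx_colsub -NV.
have Vf : colsub f V = 1%:M by rewrite /V -mulmx_colsub mulVmx.
have dV : \det (colsub f' V) = V i j.
  rewrite (@det_subst_col1 _ _ i) => [|a l li]; first by rewrite mxE ffunE eqxx.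
  have /matrixP/(_ a l) := Vf; rewrite !mxE ffunE (negbTE li); exact.
have := fmax f' isT; rewrite /vol Nf' det_mulmx normrM dV /=.
by rewrite ger_pMr// normr_gt0 -unitfE -unitmxE.
Qed.

Lemma gram_colsub {m n k : nat} (N : 'M[R]_(m, n)) (f : 'I_k -> 'I_n) :
  mxsub f f (gram N) = (colsub f N)^T *m colsub f N.
Proof. by rewrite /gram mxsub_mul trmx_mxsub. Qed.

Lemma rowsub_gram {m n k : nat} (N : 'M[R]_(m, n)) (f : 'I_k -> 'I_n) :
  rowsub f (gram N) = (colsub f N)^T *m N.
Proof. by rewrite /gram -mul_rowsub_mx trmx_mxsub. Qed.

(** The columns [f] span the column space, and the normal equations give the coefficients of all
    columns in terms of the Gram matrix alone. *)
Lemma gram_factor {m n k : nat} (N : 'M[R]_(m, n)) (f : 'I_k -> 'I_n) :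
  \rank N = k -> mxsub f f (gram N) \in unitmx ->
  N = colsub f N *m (invmx (mxsub f f (gram N)) *m rowsub f (gram N)).
Proof.
move=> rN; rewrite rowsub_gram gram_colsub; set Q := colsub f N => uQ.
have rQ : \rank Q = k.
  apply/eqP; rewrite eqn_leq rank_leq_col/=.
  by have := mxrankM_maxr Q^T Q; rewrite mxrank_unit.
have NQ : (N^T <= Q^T)%MS.
  rewrite -(mxrank_leqif_sup _).2 ?mxrank_tr ?rN ?rQ//.
  by rewrite /Q trmx_mxsub rowsub_sub.
have [W NW] := submxP NQ.
have NE : N = Q *m W^T by rewrite -[N]trmxK NW trmx_mul trmxK.
by rewrite {2}NE [Q^T *m (_ *m _)]mulmxA mulKmx.
Qed.

(** Maximal volume is applied to the row-free factor [N0] of N = Q N0; the factor [Q] cancels from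
    the coefficients, which are those of [N0]. *)
Lemma gram_minor_ex {m n k : nat} (N : 'M[R]_(m, n)) : \rank N = k ->
  exists f : {ffun 'I_k -> 'I_n}, mxsub f f (gram N) \in unitmx /\
    forall i j, `|(invmx (mxsub f f (gram N)) *m rowsub f (gram N)) i j| <= 1.
Proof.
move=> rN; have [Q [N0 [NE fN0 uQ]]] := rank_factorization rN.
have [f [uf f1]] := max_volume fN0; exists f.
have Nf : colsub f N = Q *m colsub f N0 by rewrite NE mulmx_colsub.
have uG : mxsub f f (gram N) \in unitmx.
  rewrite gram_colsub Nf trmx_mul mulmxA -[_^T *m Q^T *m Q]mulmxA.
  by rewrite !unitmx_mul unitmx_tr uf uQ.
split=> // i j; suff -> : invmx (mxsub f f (gram N)) *m rowsub f (gram N) =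
    invmx (colsub f N0) *m N0 by exact: f1.
apply: (can_inj (mulKmx uG)); rewrite mulKVmx// rowsub_gram gram_colsub.
rewrite {3}Nf -!mulmxA; congr (_ *m _).
by rewrite mulKVmx.
Qed.

Lemma rank_gram {m n : nat} (N : 'M[R]_(m, n)) : \rank (gram N) = \rank N.
Proof.
apply/eqP; rewrite eqn_leq mxrankM_maxr/=.
have [f [uf _]] := gram_minor_ex (erefl (\rank N)).
have := mxrank_unit uf => {1}<-.
rewrite mxsubrc (leq_trans (mxrankS (rowsub_sub _ _)))//.
by rewrite -mxrank_tr trmx_mxsub (leq_trans (mxrankS (rowsub_sub _ _)))// mxrank_tr.
Qed.

End column_factorization.

Section statistic_bounds.
Context {R : realType} {m p q k : nat}.
Variable A : 'M[R]_p.
Hypothesis uA : A \in unitmx.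

(* For [S = gram Y] of rank [k] and [minor_gram f S] invertible, [minor_factor]
   below factors [Y] through columns [f] of [Y *m A] and the row basis
   [minor_coef f S *m invmx A], a rational function of [S] alone; this matters
   because only [S], and not [Y], is independent of [X]. *)
Definition minor_gram (f : 'I_k -> 'I_p) (S : 'M[R]_p) : 'M[R]_k :=
  mxsub f f (A^T *m S *m A).

Definition minor_coef (f : 'I_k -> 'I_p) (S : 'M[R]_p) : 'M[R]_(k, p) :=
  adjinv (minor_gram f S) *m rowsub f (A^T *m S *m A).

(** Writing Y = Q U, this is the squared Frobenius norm of Q (Q^T Q)^-1 (U U^T)^-1, the matrix that
    turns U X into Z X. Only Q^T Q enters, hence only S. *)
Definition minor_weight (f : 'I_k -> 'I_p) (S : 'M[R]_p) : R :=
  let U := minor_coef f S *m invmx A in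
  \tr (adjinv (U *m U^T) *m adjinv (minor_gram f S) *m adjinv (U *m U^T)).

Lemma colsub_minor_coef (f : 'I_k -> 'I_p) (S : 'M[R]_p) :
  minor_gram f S \in unitmx -> colsub f (minor_coef f S) = 1%:M.
Proof.
by move=> uG; rewrite /minor_coef -mulmx_colsub -mxsubcr adjinvE// mulVmx.
Qed.

Let gramA (Y : 'M[R]_(m, p)) : A^T *m gram Y *m A = gram (Y *m A).
Proof. by rewrite /gram trmx_mul !mulmxA. Qed.

Lemma minor_factor (Y : 'M[R]_(m, p)) (f : 'I_k -> 'I_p) : \rank Y = k ->
  minor_gram f (gram Y) \in unitmx ->
  Y = colsub f (Y *m A) *m (minor_coef f (gram Y) *m invmx A).
Proof.
move=> rY uG; rewrite mulmxA -[LHS](mulmxK uA); congr (_ *m _).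
rewrite /minor_coef adjinvE//; rewrite /minor_gram gramA in uG *.
by apply: gram_factor; rewrite ?mxrankMfree ?row_free_unit.
Qed.

(** The rows of U lie in the row space of Y, so U X = U Y^T (Z X). The coefficients bounded by 1
    give |U|^2 <= kp |A^-1|^2, and |Y^T|^2 = tr S. *)
Lemma stat_F_lower (Y : 'M[R]_(m, p)) : \rank Y = k ->
  exists f : {ffun 'I_k -> 'I_p}, minor_gram f (gram Y) \in unitmx /\
    forall X : 'M[R]_(p, q),
      fnorm2 (minor_coef f (gram Y) *m invmx A *m X) <=
      (k * p)%:R * fnorm2 (invmx A) * \tr (gram Y) * stat_F X (gram Y).
Proof.
move=> rY; have rN : \rank (Y *m A) = k by rewrite mxrankMfree ?row_free_unit.
have [f [uf f1]] := gram_minor_ex rN; exists f.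
have uG : minor_gram f (gram Y) \in unitmx by rewrite /minor_gram gramA.
split=> // X; set U := _ *m invmx A.
have YU : Y = colsub f (Y *m A) *m U by exact: minor_factor.
have UE : U = invmx (minor_gram f (gram Y)) *m (colsub f (Y *m A))^T *m Y.
  rewrite {3}YU mulmxA -[_ *m _^T *m _]mulmxA -gram_colsub -gramA.
  by rewrite -/(minor_gram f _) mulVmx ?mul1mx.
have UX : U *m X = U *m Y^T *m (pinvT Y *m X).
  rewrite mulmxA; congr (_ *m X).
  by rewrite -mulmxA mul_tr_pinvT {2}UE -!mulmxA [Y *m (_ *m _)]mulmxA pinvTK mulmxA.
rewrite UX stat_F_fnorm2 (le_trans (fnorm2_mul _ _))// ler_wpM2r ?fnorm2_ge0//.
have trY : fnorm2 Y^T = \tr (gram Y) by rewrite fnorm2_trace trmxK.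
rewrite (le_trans (fnorm2_mul _ _))// trY ler_wpM2r -?trY ?fnorm2_ge0//.
rewrite (le_trans (fnorm2_mul _ _))// ler_wpM2r ?fnorm2_ge0//.
rewrite (@le_trans _ _ (\sum_(i < k) \sum_(j < p) 1))//.
  apply: ler_sum => i _; apply: ler_sum => j _.
  rewrite /minor_coef adjinvE// /minor_gram gramA -real_normK ?num_real//.
  by rewrite exprn_ile1// f1.
by rewrite !sumr_const !card_ord -mulrnA mulnC.
Qed.

Lemma stat_F_upper (Y : 'M[R]_(m, p)) (f : 'I_k -> 'I_p) (X : 'M[R]_(p, q)) :
  \rank Y = k -> minor_gram f (gram Y) \in unitmx ->
  stat_F X (gram Y) <= minor_weight f (gram Y) *
    fnorm2 (minor_coef f (gram Y) *m invmx A *m X).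
Proof.
move=> rY uG; rewrite /minor_weight; set U := _ *m invmx A.
set Q := colsub f (Y *m A).
have YU : Y = Q *m U by exact: minor_factor.
have GQ : minor_gram f (gram Y) = Q^T *m Q.
  by rewrite /minor_gram gramA gram_colsub.
clearbody U Q; have fU : row_free U.
  rewrite /row_free eqn_leq rank_leq_row/= -[leqLHS]rY {1}YU.
  exact: mxrankM_maxr.
have uU := gram_unit fU.
have uQ : Q^T *m Q \in unitmx by rewrite -GQ.
have pY : pinvT Y = Q *m invmx (Q^T *m Q) *m invmx (U *m U^T) *m U.
  apply: trmx_inj; rewrite trmx_pinvT {1}YU.
  rewrite (is_pinv_inj (pinvP _) (is_pinv_mul uQ uU)) !trmx_mul.
  by rewrite !trmx_inv !trmx_mul !trmxK !mulmxA.
rewrite stat_F_fnorm2 pY -mulmxA (le_trans (fnorm2_mul _ _))//.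
rewrite ler_wpM2r ?fnorm2_ge0// -fnorm2_tr fnorm2_trace trmxK.
rewrite !adjinvE// GQ !trmx_mul !trmx_inv !trmx_mul !trmxK.
rewrite !mulmxA -[_ *m Q^T *m Q]mulmxA.
by rewrite -[_ *m invmx (Q^T *m Q) *m (Q^T *m Q)]mulmxA mulVmx// mulmx1.
Qed.

End statistic_bounds.

(** * Integrals and independence *)

Section integral_comparison.
Local Open Scope ereal_scope.
Context {d : measure_display} {T : measurableType d} {R : realType}.
Variable mu : {measure set T -> \bar R}.

(* The integral of a nonnegative function is a supremum over the simple
   functions below it: no measurability is required to compare two of them. *)
Lemma nonneg_le_integral (f g : T -> \bar R) :
  (forall x, 0 <= f x) -> (forall x, f x <= g x) ->
  \int[mu]_x f x <= \int[mu]_x g x.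
Proof.
move=> f0 fg; rewrite !ge0_integralTE//; last first.
  by move=> x; exact: le_trans (fg x).
apply: le_ereal_sup => _ [h hf <-]; exists h => // x.
exact: le_trans (hf x) (fg x).
Qed.

(** Setting [g] to 0 on the exceptional null set keeps its integral and makes the comparison hold
    everywhere, so [f] may be non-measurable. *)
Lemma le_integral_ae_lower (f g : T -> \bar R) :
  (forall x, 0 <= f x) -> measurable_fun setT g -> (forall x, 0 <= g x) ->
  {ae mu, forall x, g x <= f x} -> \int[mu]_x g x <= \int[mu]_x f x.
Proof.
move=> f0 mg g0 [N [mN muN gfN]].
rewrite (ge0_negligible_integral mN measurableT mg _ muN)// integral_mkcond.
apply: nonneg_le_integral => x; rewrite patchE; case: ifPn => // /[!inE].
by case=> _ Nx; apply: contrapT => gf; exact/Nx/gfN.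
Qed.

Lemma le_integral_ae_upper (f g : T -> \bar R) :
  (forall x, 0 <= f x) -> measurable_fun setT g -> (forall x, 0 <= g x) ->
  {ae mu, forall x, f x <= g x} -> \int[mu]_x f x <= \int[mu]_x g x.
Proof.
move=> f0 mg g0 [N [mN muN gfN]].
(* Infinite on the null set: domination of [f] becomes pointwise while the integral of [g] is
   unchanged. *)
pose h x := g x + +oo * (\1_N x)%:E.
have mh : measurable_fun setT h.
  apply: emeasurable_funD => //; apply: emeasurable_funM => //.
  by apply/measurable_EFinP; exact: measurable_indic.
have h0 x : 0 <= h x by rewrite adde_ge0// mule_ge0// lee_fin.
rewrite (@le_trans _ _ (\int[mu]_x h x))//.
  apply: nonneg_le_integral => // x; rewrite /h indicE.
  have [Nx|/negP Nx] := boolP (x \in N).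
    by rewrite mule1 addey ?leey// gt_eqF// (lt_le_trans _ (g0 x))// ltNy0.
  rewrite mule0 adde0; apply: contrapT => fg; apply: Nx; rewrite inE.
  exact: gfN.
rewrite le_eqVlt; apply/orP; left; apply/eqP.
apply: ge0_ae_eq_integral => //; exists N; split=> // x /=.
rewrite not_implyE => -[_ hg]; apply: contrapT => Nx; apply: hg.
by rewrite /h indicE memNset// mule0 adde0.
Qed.

End integral_comparison.

Section independent_integral.
Local Open Scope ereal_scope.
Context {d d1 d2 : measure_display} {T : measurableType d}
  {T1 : measurableType d1} {T2 : measurableType d2} {R : realType}.
Variable P : probability T R.

(** The joint law is the product measure by uniqueness on rectangles, and Tonelli applies. *)
Lemma indep_integral (X : T -> T1) (W : T -> T2) (m1 : probability T1 R)
    (f : T1 * T2 -> \bar R) :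
  measurable_fun setT X -> measurable_fun setT W ->
  (forall A B, measurable A -> measurable B ->
    P (X @^-1` A `&` W @^-1` B) = m1 A * P (W @^-1` B)) ->
  measurable_fun setT f -> (forall z, 0 <= f z) ->
  \int[P]_w f (X w, W w) = \int[P]_w \int[m1]_x f (x, W w).
Proof.
move=> mX mW XW mf f0.
pose W' : {RV P >-> T2} := HB.pack W (isMeasurableFun.Build _ _ _ _ W mW).
have mXW : measurable_fun setT (fun w => (X w, W w)).
  exact: measurable_fun_pair.
pose XW' : {RV P >-> (T1 * T2)%type} :=
  HB.pack (fun w => (X w, W w)) (isMeasurableFun.Build _ _ _ _ _ mXW).
transitivity (\int[distribution P XW']_z f z).
  by rewrite ge0_integral_distribution.
transitivity (\int[m1 \x distribution P W']_z f z).
  apply: eq_measure_integral => A mA _; apply/esym.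
  exact: product_measure_unique.
rewrite fubini_tonelli2// ge0_integral_distribution//.
- exact: measurable_fun_fubini_tonelli_G.
- by move=> y; exact: integral_ge0.
Qed.

End independent_integral.

(** * Gaussian matrices *)

Section matrix_measurability.
Context {R : realType}.

(** Rewriting as x times the real power -1 of x^2 avoids a case split at 0, where both sides take
    the value 0. *)
Lemma measurable_inv : measurable_fun [set: R] (fun x : R => x^-1).
Proof.
rewrite (_ : (fun _ => _) = fun x : R => x * (x ^+ 2) `^ (-1)); last first.
  apply/funext => x; rewrite powR_inv1 ?sqr_ge0// expr2.
  have [->|x0] := eqVneq x 0; first by rewrite invr0 mul0r.
  by rewrite invfM mulrA divff// mul1r.
apply: measurable_funM => //.
have m1 : measurable_fun [set: R] (fun x : R => x ^+ 2) by exact: measurable_funX.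
have m2 := @measurable_powR R (-1).
exact: (measurableT_comp m2 m1).
Qed.

Lemma measurable_entry {m n : nat} i j :
  measurable_fun setT (fun M : 'M[R]_(m, n) => M i j).
Proof.
move=> _ B mB; rewrite setTI; apply: sub_sigma_algebra; exists (i, j) => //.
by exists B => //; rewrite setTI.
Qed.

Context {d : measure_display} {T : measurableType d}.

Lemma measurable_fun_mx {m n : nat} (f : T -> 'M[R]_(m, n)) :
  (forall i j, measurable_fun setT (fun x => f x i j)) -> measurable_fun setT f.
Proof.
move=> mf; apply: (@measurability _ _ _ _ _ _ (\bigcup_(ij : 'I_m * 'I_n)
    preimage_set_system setT (fun M : 'M[R]_(m, n) => M ij.1 ij.2) measurable)).
  by [].
move=> _ [_ [[i j] _ [B mB <-]] <-].
by rewrite !setTI; have := mf i j measurableT B mB; rewrite setTI.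
Qed.

Lemma measurable_fun_entry {m n : nat} (f : T -> 'M[R]_(m, n)) i j :
  measurable_fun setT f -> measurable_fun setT (fun x => f x i j).
Proof. by move=> mf; exact: (measurableT_comp (measurable_entry i j)). Qed.

Lemma measurable_fun_mulmx {m n k : nat} (f : T -> 'M[R]_(m, n))
    (g : T -> 'M[R]_(n, k)) : measurable_fun setT f -> measurable_fun setT g ->
  measurable_fun setT (fun x => f x *m g x).
Proof.
move=> mf mg; apply: measurable_fun_mx => i j.
under eq_fun do rewrite mxE.
by apply: measurable_sum => l; apply: measurable_funM; exact: measurable_fun_entry.
Qed.

Lemma measurable_fun_trmx {m n : nat} (f : T -> 'M[R]_(m, n)) :
  measurable_fun setT f -> measurable_fun setT (fun x => (f x)^T).
Proof.
move=> mf; apply: measurable_fun_mx => i j; under eq_fun do rewrite mxE.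
exact: measurable_fun_entry.
Qed.

Lemma measurable_fun_mxsub {m n m' n' : nat} (f : T -> 'M[R]_(m, n))
    (a : 'I_m' -> 'I_m) (b : 'I_n' -> 'I_n) :
  measurable_fun setT f -> measurable_fun setT (fun x => mxsub a b (f x)).
Proof.
move=> mf; apply: measurable_fun_mx => i j; under eq_fun do rewrite mxE.
exact: measurable_fun_entry.
Qed.

Lemma measurable_fun_mxtrace {n : nat} (f : T -> 'M[R]_n) :
  measurable_fun setT f -> measurable_fun setT (fun x => \tr (f x)).
Proof. by move=> mf; apply: measurable_sum => i; exact: measurable_fun_entry. Qed.

Lemma measurable_fun_det {n : nat} (f : T -> 'M[R]_n) :
  measurable_fun setT f -> measurable_fun setT (fun x => \det (f x)).
Proof.
move=> mf; apply: measurable_sum => s; apply: measurable_funM => //.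
elim: (index_enum _) => [|i l ih].
  by under eq_fun do rewrite big_nil; exact: measurable_cst.
under eq_fun do rewrite big_cons.
by apply: measurable_funM ih; exact: measurable_fun_entry.
Qed.

Lemma measurable_fun_adjinv {n : nat} (f : T -> 'M[R]_n) :
  measurable_fun setT f -> measurable_fun setT (fun x => adjinv (f x)).
Proof.
move=> mf; apply: measurable_fun_mx => i j.
under eq_fun do rewrite !mxE.
apply: measurable_funM.
  by apply: (measurableT_comp measurable_inv) => //; exact: measurable_fun_det.
apply: measurable_funM => //; apply: measurable_fun_det.
apply: measurable_fun_mx => k l; under eq_fun do rewrite !mxE.
exact: measurable_fun_entry.
Qed.

End matrix_measurability.

Section gaussian_entries.
Context {R : realType} {d du : measure_display} {T : measurableType d}
  {U : measurableType du}.
Variable P : probability T R.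
Context {p q : nat}.
Variables (Z : T -> 'M[R]_(p, q)) (W : T -> U).
Local Notation N01 := (normal_prob (0 : R) 1).
Local Notation idx := ('I_p * 'I_q)%type.

(** I.i.d. N(0, 1) entries, jointly independent of [W], stated on boxes: this is what the model
    provides, and boxes generate the sigma-algebra ([measurable_boxes]). *)
Definition gaussian_indep : Prop :=
  forall (B : idx -> set R) (C : set U),
  (forall e, measurable (B e)) -> measurable C ->
  P [set w | (forall e, B e (Z w e.1 e.2)) /\ C (W w)] =
  ((\prod_e N01 (B e)) * P (W @^-1` C))%E.

(** Overwriting entry [e] by a constant keeps exactly the information of the other entries without
    changing the matrix type. *)
Definition set_entry (e : idx) (x : R) (M : 'M[R]_(p, q)) : 'M[R]_(p, q) :=
  \matrix_(i, j) if (i, j) == e then x else M i j.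

Hypotheses (mZ : measurable_fun setT Z) (mW : measurable_fun setT W).
Hypothesis ZW : gaussian_indep.

Definition boxes : set (set ('M[R]_(p, q) * U)) :=
  [set D | exists (B : idx -> set R) (C : set U),
    [/\ forall e, measurable (B e), measurable C &
        D = [set z : 'M[R]_(p, q) * U |
              (forall e, B e (z.1 e.1 e.2)) /\ C z.2]]].

Lemma boxes_setI : setI_closed boxes.
Proof.
move=> _ _ [B [C [mB mC ->]]] [B' [C' [mB' mC' ->]]].
exists (fun e => B e `&` B' e), (C `&` C'); split.
- by move=> e; exact: measurableI.
- exact: measurableI.
- apply/seteqP; split=> z /=.
    by move=> [[Bz Cz] [Bz' Cz']]; split=> // e; split.
  by move=> [BBz [Cz Cz']]; split; split=> // e; case: (BBz e).
Qed.

Lemma measurable_boxes :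
  @measurable _ ('M[R]_(p, q) * U)%type = <<s boxes >>.
Proof.
apply/seteqP; split; last first.
  apply: smallest_sub; first exact: sigma_algebra_measurable.
  move=> _ [B [C [mB mC ->]]].
  rewrite (_ : [set _ | _] = (\bigcap_(e in setT)
    ((fun z : 'M[R]_(p, q) * U => z.1 e.1 e.2) @^-1` (B e))) `&` snd @^-1` C).
    apply: measurableI.
      apply: fin_bigcap_measurable => // e _.
      have me : measurable_fun setT (fun z : 'M[R]_(p, q) * U => z.1 e.1 e.2).
        exact: (measurableT_comp (measurable_entry e.1 e.2)).
      by have := me measurableT _ (mB e); rewrite setTI.
    by rewrite -[X in measurable X]setTI; exact: measurable_snd.
  by apply/seteqP; split=> z /= [Bz Cz]; split=> // e; [move=> _|]; exact: Bz.
apply: smallest_sub; first exact: smallest_sigma_algebra.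
rewrite subUset; split=> [_ [A mA <-]|_ [C mC <-]]; last first.
  apply: sub_sigma_algebra; exists (fun=> setT), C; split=> //.
  by apply/seteqP; split=> z /= [].
rewrite setTI; move: A mA.
apply: smallest_sub.
  have := sigma_algebra_image (fst : 'M[R]_(p, q) * U -> _)
    (@smallest_sigma_algebra _ setT boxes).
  rewrite /image_set_system; congr (sigma_algebra _ _).
  by apply/funext => A /=; rewrite setTI.
move=> _ [e _ [B mB <-]] /=; apply: sub_sigma_algebra.
exists (fun e' => if e' == e then B else setT), setT; split=> //.
  by move=> e'; case: ifP.
apply/seteqP; split=> z /=.
  by move=> [_ Bz]; split=> // e'; case: ifPn => // /eqP ->.
by move=> [Bz _]; split=> //; have := Bz e; rewrite eqxx.
Qed.

Lemma measurable_set_entry e {d' : measure_display} {V : measurableType d'}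
    (f : V -> R) (g : V -> 'M[R]_(p, q)) :
  measurable_fun setT f -> measurable_fun setT g ->
  measurable_fun setT (fun v => set_entry e (f v) (g v)).
Proof.
move=> mf mg; apply: measurable_fun_mx => i j; under eq_fun do rewrite mxE.
by case: eqP => // _; exact: measurable_fun_entry.
Qed.

Let zeroed e w := (set_entry e 0 (Z w), W w).

Let measurable_zeroed e : measurable_fun setT (zeroed e).
Proof. by apply: measurable_fun_pair => //; exact: measurable_set_entry. Qed.

Lemma entry_indep e (A : set R) (D : set ('M[R]_(p, q) * U)) :
  measurable A -> measurable D ->
  P ((fun w => Z w e.1 e.2) @^-1` A `&` zeroed e @^-1` D) =
  (N01 A * P (zeroed e @^-1` D))%E.
Proof.
move=> mA mD.
have mZA : measurable ((fun w => Z w e.1 e.2) @^-1` A).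
  have := measurable_fun_entry e.1 e.2 mZ measurableT mA.
  by rewrite setTI.
pose V : {mfun T >-> ('M[R]_(p, q) * U)%type} :=
  HB.pack (zeroed e) (isMeasurableFun.Build _ _ _ _ _ (measurable_zeroed e)).
have [a a0 Na] : exists2 a : R, (0 <= a)%R & N01 A = a%:E.
  have Nf : N01 A \is a fin_num by exact: fin_num_measure.
  by exists (fine (N01 A)); rewrite ?fineK// fine_ge0.
(* Two finite measures, compared on the pi-system of boxes: the law of [zeroed e] on the event that
   the entry lies in [A], and [N01 A] times its full law. *)
pose m1 : {measure set _ -> \bar R} :=
  measure_function_pushforward__canonical__measure_function_Measure
    (mrestr P mZA) (measurable_zeroed e).
pose m2 : {measure set _ -> \bar R} := mscale (NngNum a0) (distribution P V).
have : m1 D = m2 D.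
  apply: (measure_unique boxes (fun=> setT)) => //=.
  - exact: measurable_boxes.
  - exact: boxes_setI.
  - move=> _; exists (fun=> setT), setT; split=> //.
    by apply/seteqP; split=> z.
  - by rewrite bigcup_const.
  - move=> _ [B [C [mB mC ->]]].
    rewrite /m1 /m2 /mscale/= /pushforward /distribution /mrestr/=.
    rewrite /pushforward/= -Na.
    (* The zeroed entry equals 0: a box either contains it, and then does not constrain entry [e],
       or has empty preimage. *)
    have [B0|nB0] := pselect (B e 0); last first.
      have -> : zeroed e @^-1` [set z : 'M[R]_(p, q) * U |
          (forall e0 : idx, B e0 (z.1 e0.1 e0.2)) /\ C z.2] = set0.
        by apply/seteqP; split=> w //= [/(_ e)]; rewrite mxE -surjective_pairing eqxx.
      by rewrite set0I measure0 mule0.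
    pose BA A' e' := if e' == e then A' else B e'.
    have mBA A' : measurable A' -> forall e', measurable (BA A' e').
      by move=> mA' e'; rewrite /BA; case: ifP.
    have zE : zeroed e @^-1` [set z : 'M[R]_(p, q) * U |
        (forall e0 : idx, B e0 (z.1 e0.1 e0.2)) /\ C z.2] =
        [set w | (forall e', BA setT e' (Z w e'.1 e'.2)) /\ C (W w)].
      apply/seteqP; split=> w /= [Bw Cw]; split=> // e'; have := Bw e';
        by rewrite /BA mxE -surjective_pairing; case: eqP => // ->.
    have zAE : [set w | (forall e', BA setT e' (Z w e'.1 e'.2)) /\ C (W w)] `&`
        (fun w => Z w e.1 e.2) @^-1` A =
        [set w | (forall e', BA A e' (Z w e'.1 e'.2)) /\ C (W w)].
      apply/seteqP; split=> w /=.
        move=> [[Bw Cw] Aw]; split=> // e'; have := Bw e'.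
        by rewrite /BA; case: eqP => // ->.
      move=> [Bw Cw]; have := Bw e; rewrite /BA eqxx => Aw; split=> //.
      by split=> // e'; have := Bw e'; rewrite /BA; case: eqP.
    rewrite zE zAE !ZW//; [|exact: mBA..].
    rewrite muleA; congr (_ * _)%E.
    rewrite (bigD1 e)//= [in RHS](bigD1 e)//= /BA eqxx probability_setT mul1e.
    by congr (_ * _)%E; apply: eq_bigr => e' /negbTE ->.
  - move=> _; rewrite /m1/= /pushforward/= preimage_setT.
    by rewrite (le_lt_trans (probability_le1 _ _)) ?ltry//; exact: measurableI.
rewrite /m1 /m2 /= Na /pushforward /mrestr/= /mscale/= /distribution.
by rewrite /pushforward/= setIC.
Qed.

End gaussian_entries.

(** * Small-ball estimates for shifted normal entries *)

Section gaussian_window.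
Local Open Scope ereal_scope.
Context {R : realType}.
Local Notation N01 := (normal_prob (0 : R) 1).

Definition window (t x : R) : \bar R := ((`|x| <= t)%R%:R)%:E.

Definition window_mass (t b : R) : \bar R := \int[N01]_x window t (x + b)%R.

Lemma window_ge0 t x : 0 <= window t x. Proof. by rewrite lee_fin. Qed.

Lemma measurable_window t : measurable_fun setT (window t).
Proof.
apply/measurable_EFinP.
rewrite (_ : (fun _ => _) = \1_(`[(- t)%R, t]%classic : set R)).
  by apply: measurable_indic; exact: measurable_itv.
apply/funext => x; rewrite indicE; congr (_%:R).
by rewrite mem_setE/= in_itv/= ler_norml.
Qed.

Lemma measurable_window_add t :
  measurable_fun [set: R * R] (fun z => window t (z.1 + z.2)%R).
Proof.
apply: (measurableT_comp (measurable_window t)).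
by apply: measurable_funD => //.
Qed.

Lemma measurable_window_mass t : measurable_fun setT (window_mass t).
Proof.
have := @measurable_fun_fubini_tonelli_G _ _ _ _ R N01 _ (measurable_window_add t).
by apply => z; exact: window_ge0.
Qed.

Lemma window_mass_ge0 t b : 0 <= window_mass t b.
Proof. by apply: integral_ge0 => x _; exact: window_ge0. Qed.

Lemma window_massE t b :
  window_mass t b = N01 (`[(- t - b)%R, (t - b)%R]%classic).
Proof.
rewrite /window_mass -[RHS]mul1e -integral_cst; last exact: measurable_itv.
rewrite [RHS]integral_mkcond; apply: eq_integral => x _.
rewrite patchE /window mem_setE/= in_itv/= ler_norml.
by rewrite lerBlDr lerBrDr; case: ifP.
Qed.

Lemma lebesgue_window t b : (0 <= t)%R ->
  lebesgue_measure (`[(- t - b)%R, (t - b)%R]%classic : set R) = (2 * t)%:E.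
Proof.
move=> t0; rewrite lebesgue_measure_itv/= lte_fin ltrD2r.
case: ltP => [_|tt].
  by rewrite -EFinD; congr EFin; ring.
have -> : t = 0%R by lra.
by rewrite mulr0.
Qed.

Lemma window_mass_ub t b : (0 <= t)%R ->
  window_mass t b <= (normal_peak 1 * (2 * t))%:E.
Proof.
move=> t0; rewrite window_massE EFinM -(lebesgue_window b t0) -integral_cst//.
apply: ge0_le_integral => //.
- by move=> x _; rewrite lee_fin normal_pdf_ge0.
- by apply/measurable_EFinP/measurable_funTS; exact: measurable_normal_pdf.
- by move=> x _; rewrite lee_fin normal_pdf_ub// oner_eq0.
Qed.

(** For t <= 1 the interval [-t - b, t - b] stays within distance |b| + 1 of 0, so this bounds the
    density from below there, independently of t. *)
Definition window_density (b : R) : R := normal_pdf 0 1 (`|b| + 1)%R.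

Lemma window_density_gt0 b : (0 < window_density b)%R.
Proof.
rewrite /window_density normal_pdfE ?oner_eq0//.
by rewrite mulr_gt0 ?expR_gt0// normal_peak_gt0// oner_eq0.
Qed.

Lemma measurable_window_density : measurable_fun setT window_density.
Proof.
apply: (measurableT_comp (measurable_normal_pdf 0%R 1%R)).
by apply: measurable_funD => //; exact: measurable_normr.
Qed.

Lemma window_mass_lb t b : (0 <= t <= 1)%R ->
  (window_density b * (2 * t))%:E <= window_mass t b.
Proof.
move=> /andP[t0 t1]; rewrite window_massE EFinM -(lebesgue_window b t0).
rewrite -integral_cst//; apply: ge0_le_integral => //.
- by move=> x _; rewrite lee_fin ltW// window_density_gt0.
- by apply/measurable_EFinP/measurable_funTS; exact: measurable_normal_pdf.
move=> x /=; rewrite in_itv/= => /andP[tx xt].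
rewrite lee_fin /window_density !normal_pdfE ?oner_eq0//.
rewrite ler_pM2l ?normal_peak_gt0 ?oner_eq0// ler_expR !subr0 !mulNr lerN2.
rewrite ler_pM2r ?invr_gt0 ?expr1n ?ltr0n//.
rewrite -[(x ^+ 2)%R]real_normK ?num_real// lerXn2r ?nnegrE ?addr_ge0//.
rewrite ler_norml; have := ler_norm b; have := ler_norm (- b)%R.
by rewrite normrN => b1 b2; apply/andP; split; lra.
Qed.

End gaussian_window.

Section gaussian_boxes.
Local Open Scope ereal_scope.
Context {R : realType} {d du : measure_display} {T : measurableType d}
  {U : measurableType du}.
Variable P : probability T R.
Context {p q : nat}.
Variables (Z : T -> 'M[R]_(p, q)) (W : T -> U).
Local Notation N01 := (normal_prob (0 : R) 1).
Local Notation idx := ('I_p * 'I_q)%type.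
Local Notation state := ('M[R]_(p, q) * U)%type.

Hypotheses (mZ : measurable_fun setT Z) (mW : measurable_fun setT W).
Hypothesis ZW : gaussian_indep P Z W.

(** Conditioning on [W] and the other entries is expressed by functions that ignore entry [e]. *)
Definition insensitive {V : Type} (e : idx) (f : state -> V) : Prop :=
  forall x M u, f (set_entry e x M, u) = f (M, u).

Lemma measurable_state : measurable_fun setT (fun w => (Z w, W w)).
Proof. exact: measurable_fun_pair. Qed.

Lemma window_integral1 e (g : state -> \bar R) (b : state -> R) (t : R) :
  measurable_fun setT g -> (forall z, 0 <= g z) -> insensitive e g ->
  measurable_fun setT b -> insensitive e b ->
  \int[P]_w (g (Z w, W w) * window t (Z w e.1 e.2 + b (Z w, W w))%R) =
  \int[P]_w (g (Z w, W w) * window_mass t (b (Z w, W w))).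
Proof.
move=> mg g0 ge mb be.
pose f (z : R * state) := g z.2 * window t (z.1 + b z.2)%R.
pose V w := (set_entry e 0 (Z w), W w).
have mV : measurable_fun setT V.
  by apply: measurable_fun_pair => //; exact: measurable_set_entry.
transitivity (\int[P]_w f (Z w e.1 e.2, V w)).
  by apply: eq_integral => w _; rewrite /f /V/= ge be.
have mf : measurable_fun setT f.
  apply: emeasurable_funM; first exact: (measurableT_comp mg).
  apply: (measurableT_comp (measurable_window t)).
  by apply: measurable_funD => //; exact: (measurableT_comp mb).
rewrite (@indep_integral _ _ _ _ (measurableTypeR R) _ _ P
  (fun w => Z w e.1 e.2) V N01 f)//.
- apply: eq_integral => w _; rewrite /f/= ge0_integralZl//.
  + by rewrite /V ge be.
  + apply: (measurableT_comp (measurable_window t)).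
    exact: measurable_funD.
  + by move=> x _; exact: window_ge0.
- exact: measurable_fun_entry.
- by move=> A B mA mB; exact: entry_indep.
- by move=> z; rewrite mule_ge0// window_ge0.
Qed.

(** Entries are integrated out one at a time. The windows still to come ignore the current entry,
    and a mass already produced ignores all listed entries, so it can be absorbed into [g]. *)
Lemma window_integral (I : eqType) (ent : I -> idx) (es : seq I)
    (g : state -> \bar R) (b : I -> state -> R) (t : R) :
  injective ent -> uniq es ->
  measurable_fun setT g -> (forall z, 0 <= g z) ->
  (forall e, insensitive (ent e) g) ->
  (forall e, measurable_fun setT (b e)) ->
  (forall e e', insensitive (ent e) (b e')) ->
  \int[P]_w (g (Z w, W w) *
    \prod_(e <- es) window t (Z w (ent e).1 (ent e).2 + b e (Z w, W w))%R) =
  \int[P]_w (g (Z w, W w) * \prod_(e <- es) window_mass t (b e (Z w, W w))).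
Proof.
move=> entI; elim: es g => [|e es ih] g /=.
  by move=> _ _ _ _ _ _; under eq_integral do rewrite big_nil;
     under [RHS]eq_integral do rewrite big_nil.
move=> /andP[ees ues] mg g0 ge mb be.
have mm e' : measurable_fun setT (fun z => window_mass t (b e' z)).
  exact: (measurableT_comp (measurable_window_mass t)).
pose y e' (z : state) := (z.1 (ent e').1 (ent e').2 + b e' z)%R.
pose g1 z := g z * \prod_(e' <- es) window t (y e' z).
transitivity (\int[P]_w (g1 (Z w, W w) * window t (y e (Z w, W w)))).
  by apply: eq_integral => w _; rewrite big_cons /g1/= muleA muleAC.
rewrite window_integral1//.
- transitivity (\int[P]_w ((g (Z w, W w) * window_mass t (b e (Z w, W w))) *
      \prod_(e' <- es) window t (y e' (Z w, W w)))).
    by apply: eq_integral => w _; rewrite /g1/= muleAC.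
  rewrite (ih (fun z => g z * window_mass t (b e z)))//.
  + by apply: eq_integral => w _; rewrite big_cons muleA.
  + exact: emeasurable_funM.
  + by move=> z; rewrite mule_ge0// window_mass_ge0.
  + by move=> e' x M u; rewrite ge be.
- apply: emeasurable_funM => //; rewrite /=.
  elim: (es) => [|e' s ihs].
    by under eq_fun do rewrite big_nil; exact: measurable_cst.
  under eq_fun do rewrite big_cons.
  apply: emeasurable_funM => //; apply: (measurableT_comp (measurable_window t)).
  apply: measurable_funD => //.
  exact: (measurableT_comp (measurable_entry _ _) measurable_fst).
- by move=> z; rewrite mule_ge0// prode_ge0// => e' _; exact: window_ge0.
- move=> x M u; rewrite /g1 ge; congr (_ * _).
  apply: eq_big_seq => e' e'es; rewrite /y/= mxE -surjective_pairing be.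
  by rewrite ifF//; apply: contraNF ees => /eqP/entI <-.
Qed.

End gaussian_boxes.

(** * From the normal model to independent standard normal entries *)

Section positive_definite_roots.
Context {R : realType} {p : nat}.
Implicit Types M A B : 'M[R]_p.

Lemma posdefmx_unit M : posdefmx M -> M \in unitmx.
Proof.
move=> [Msym Mpos]; rewrite -row_free_unit -kermx_eq0; apply/rowV0P => v.
move/sub_kermxP => vM; apply/eqP; apply: contraPT isT => v0 _.
have := Mpos v^T; rewrite trmxK vM mul0mx mxE ltxx => /(_ _)/notF.
by apply; rewrite -trmx_eq0 trmxK.
Qed.

(** With D = A - B one has A D = - D B, so the nonnegative traces of D A D and D B D add up to 0,
    and definiteness of A kills every column of D. Needed because [mvnormal] only asserts that some
    root exists, possibly a different one for each column. *)
Lemma posdef_sqrt_uniq M A B : posdef_sqrt M A -> posdef_sqrt M B -> A = B.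
Proof.
move=> [[Asym Apos] AM] [[Bsym Bpos] BM]; pose D := A - B.
have ADB : A *m D = - (D *m B).
  by rewrite /D mulmxBr mulmxBl AM BM opprB.
have Dsym : D^T = D by rewrite /D raddfB/= Asym Bsym.
have trq (N : 'M[R]_p) : \tr (D *m N *m D) =
    \sum_j ((col j D)^T *m N *m col j D) 0 0.
  apply: eq_bigr => j _; rewrite -{1}Dsym !mxE; apply: eq_bigr => k _.
  by rewrite !mxE; congr (_ * _); apply: eq_bigr => l _; rewrite !mxE.
have ge0 (N : 'M[R]_p) : (forall v : 'cV_p, v != 0 -> 0 < (v^T *m N *m v) 0 0) ->
    forall v : 'cV_p, 0 <= (v^T *m N *m v) 0 0.
  move=> Npos v; have [->|/Npos/ltW//] := eqVneq v 0.
  by rewrite trmx0 !mul0mx mxE.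
have : \tr (D *m A *m D) + \tr (D *m B *m D) = 0.
  by rewrite -[D *m A *m D]mulmxA ADB mulmxN raddfN/= [X in - X + _]mxtrace_mulC addNr.
move=> /eqP; rewrite paddr_eq0; last 2 first.
  by rewrite trq sumr_ge0// => j _; exact: ge0.
  by rewrite trq sumr_ge0// => j _; exact: ge0.
move=> /andP[+ _]; rewrite trq psumr_eq0 => [/allP Dj|j _]; last exact: ge0.
apply/eqP; rewrite -subr_eq0 -/D; apply/eqP/matrixP => i j.
have := Dj j (mem_index_enum j); rewrite implyTb.
case: (eqVneq (col j D) 0) => [/matrixP/(_ i 0)|/Apos]; first by rewrite !mxE.
by move=> /[swap] /eqP ->; rewrite ltxx.
Qed.

Lemma posdef_sqrtZ M A (k : R) : 0 < k -> posdef_sqrt M A ->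
  posdef_sqrt (k ^+ 2 *: M) (k *: A).
Proof.
move=> k0 [[Asym Apos] AM]; split; last first.
  by rewrite -scalemxAl -scalemxAr scalerA AM expr2.
split=> [|v v0]; first by rewrite linearZ/= Asym.
by rewrite -scalemxAr -scalemxAl mxE mulr_gt0// Apos.
Qed.

End positive_definite_roots.

Section gaussian_model.
Context {R : realType} {d du : measure_display} {T : measurableType d}
  {U : measurableType du}.
Variable P : probability T R.
Local Notation N01 := (normal_prob (0 : R) 1).

Lemma std_normal_vector_prob {p : nat} (z : T -> 'cV[R]_p) (B : 'I_p -> set R) :
  std_normal_vector P z -> (forall i, measurable (B i)) ->
  P [set w | forall i, B i (z w i 0)] = (\prod_i N01 (B i))%E.
Proof.
move=> [zind zn] mB; have := zind [set: 'I_p]%SET B mB.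
rewrite (_ : \bigcap_(_ in _) _ = [set w | forall i, B i (z w i 0)]).
  move=> ->; rewrite big_mkcond/=; apply: eq_bigr => i _; rewrite inE zn//.
by apply/seteqP; split=> w /= h i; [apply: (h i); rewrite /= inE|move=> _; exact: h].
Qed.

Lemma normal_columns_gaussian {p q : nat} (theta : 'M[R]_(p, q)) (Sigma A : 'M[R]_p)
    (X : T -> 'M[R]_(p, q)) (S : T -> U) :
  posdef_sqrt Sigma A -> normal_columns P theta Sigma X -> independent P X S ->
  gaussian_indep P (fun w => invmx A *m (X w - theta)) S.
Proof.
move=> AS [Xind Xn] XS B C mB mC.
have mlin (n : nat) (t : 'M[R]_(p, n)) i j :
    measurable_fun [set: 'M[R]_(p, n)] (fun M => (invmx A *m (M - t)) i j).
  apply: measurable_fun_entry; apply: measurable_fun_mulmx.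
    exact: measurable_cst.
  apply: measurable_fun_mx => k l; under eq_fun do rewrite !mxE.
  by apply: measurable_funB; [exact: measurable_entry|exact: measurable_cst].
pose BX := [set M : 'M[R]_(p, q) | forall e, B e ((invmx A *m (M - theta)) e.1 e.2)].
pose Bc j := [set c : 'cV[R]_p | forall i,
  B (i, j) ((invmx A *m (c - col j theta)) i 0)].
have mBX : measurable BX.
  rewrite (_ : BX = \bigcap_(e in setT)
    ((fun M => (invmx A *m (M - theta)) e.1 e.2) @^-1` B e)).
    apply: fin_bigcap_measurable => // e _.
    by have := mlin _ theta e.1 e.2 measurableT _ (mB e); rewrite setTI.
  by apply/seteqP; split=> M /= h e; [move=> _|]; exact: h.
have mBc j : measurable (Bc j).
  rewrite (_ : Bc j = \bigcap_(i in setT)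
    ((fun c => (invmx A *m (c - col j theta)) i 0) @^-1` B (i, j))).
    apply: fin_bigcap_measurable => // i _.
    by have := mlin _ (col j theta) i 0 measurableT _ (mB (i, j)); rewrite setTI.
  by apply/seteqP; split=> M /= h e; [move=> _|]; exact: h.
rewrite (_ : [set w | _] = X @^-1` BX `&` S @^-1` C); last first.
  by apply/seteqP; split.
rewrite XS//; congr (_ * _)%E.
have -> : X @^-1` BX = \bigcap_(j in [set` [set: 'I_q]%SET])
    ((fun w => col j (X w)) @^-1` Bc j).
  apply/seteqP; split=> w /=.
    move=> Bw j _ i /=; have := Bw (i, j); congr (B _ _).
    by rewrite /= !mxE; apply: eq_bigr => k _; rewrite !mxE.
  move=> Bw [i j]; have := Bw j; rewrite /= inE => /(_ isT i); congr (B _ _).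
  by rewrite /= !mxE; apply: eq_bigr => k _; rewrite !mxE.
rewrite Xind// big_mkcond/=.
rewrite (eq_bigr (fun j => \prod_i N01 (B (i, j)))%E) => [|j _].
  by rewrite exchange_big pair_big/=; apply: eq_bigr => -[i j].
rewrite inE; have [A' A'S An] := Xn j.
rewrite (posdef_sqrt_uniq A'S AS) in An.
by have := @std_normal_vector_prob _ _ (fun i => B (i, j)) An; apply.
Qed.

(** No second variable is needed for Y, hence the constant [tt]. Symmetry of the root translates
    between rows and the column vectors of [mvnormal]. *)
Lemma normal_rows_gaussian {m p : nat} (Sigma A : 'M[R]_p)
    (Y : T -> 'M[R]_(m, p)) :
  posdef_sqrt Sigma A -> normal_rows P Sigma Y ->
  gaussian_indep P (fun w => Y w *m invmx A) (fun=> tt).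
Proof.
move=> AS [Yind Yn] B C mB mC.
have Asym : (invmx A)^T = invmx A by case: AS => -[As _] _; rewrite trmx_inv As.
have mlin i : measurable_fun [set: 'rV[R]_p] (fun v => (v *m invmx A) 0 i).
  by apply: measurable_fun_entry; exact: measurable_fun_mulmx.
pose Br a := [set v : 'rV[R]_p | forall i, B (a, i) ((v *m invmx A) 0 i)].
have mBr a : measurable (Br a).
  rewrite (_ : Br a = \bigcap_(i in setT)
    ((fun v => (v *m invmx A) 0 i) @^-1` B (a, i))).
    apply: fin_bigcap_measurable => // i _.
    by have := mlin i measurableT _ (mB (a, i)); rewrite setTI.
  by apply/seteqP; split=> M /= h e; [move=> _|]; exact: h.
have prodB : P [set w | forall e, B e ((Y w *m invmx A) e.1 e.2)] =
    (\prod_e N01 (B e))%E.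
  have -> : [set w | forall e, B e ((Y w *m invmx A) e.1 e.2)] =
      \bigcap_(a in [set` [set: 'I_m]%SET]) ((fun w => row a (Y w)) @^-1` Br a).
    apply/seteqP; split=> w /=.
      move=> Bw a _ i /=; have := Bw (a, i); congr (B _ _).
      by rewrite /= !mxE; apply: eq_bigr => k _; rewrite !mxE.
    move=> Bw [a i]; have := Bw a; rewrite /= inE => /(_ isT i); congr (B _ _).
    by rewrite /= !mxE; apply: eq_bigr => k _; rewrite !mxE.
  rewrite Yind// big_mkcond/=.
  rewrite (eq_bigr (fun a => \prod_i N01 (B (a, i)))%E) => [|a _].
    by rewrite pair_big/=; apply: eq_bigr => -[i j].
  rewrite inE; have [A' A'S An] := Yn a.
  rewrite (posdef_sqrt_uniq A'S AS) in An.
  rewrite -(std_normal_vector_prob An) => [|i]; last exact: mB.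
  have trE w i : (invmx A *m ((row a (Y w))^T - 0)) i 0 =
      (row a (Y w) *m invmx A) 0 i.
    by rewrite subr0 -{1}Asym -trmx_mul mxE.
  by congr (P _); apply/seteqP; split=> w /= Bw i; have := Bw i; rewrite trE.
have [Ctt|nCtt] := pselect (C tt).
  rewrite (_ : (fun=> tt) @^-1` C = setT); last by apply/seteqP; split.
  rewrite probability_setT mule1 -prodB; congr (P _).
  by apply/seteqP; split=> w /= => [[]|].
rewrite (_ : (fun=> tt) @^-1` C = set0); last by apply/seteqP; split.
rewrite measure0 mule0 (_ : [set w | _] = set0) ?measure0//.
by apply/seteqP; split=> w //= [].
Qed.

End gaussian_model.

(** * Second moments, null sets and almost sure full rank *)

Section normal_second_moment.
Local Open Scope ereal_scope.
Context {R : realType}.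
Local Notation N01 := (normal_prob (0 : R) 1).
Local Notation mu := (@lebesgue_measure R).

(** The inequality x^2 exp(- x^2 / 4) <= 4 dominates the integrand by a multiple of the N(0, 2)
    density, whose integral is 1. This avoids any integration by parts. *)
Lemma normal_second_moment : \int[N01]_x (x ^+ 2)%R%:E < +oo.
Proof.
have numu : N01 `<< mu := normal_prob_dominates 0 1.
pose g := Radon_Nikodym_SigmaFinite.f N01 mu.
have g0 := Radon_Nikodym_SigmaFinite.f_ge0 numu : forall x, 0 <= g x.
have gi := Radon_Nikodym_SigmaFinite.f_integrable numu.
have mx2 : measurable_fun [set: R] (fun x => (x ^+ 2)%R%:E).
  by apply/measurable_EFinP; exact: measurable_funX.
have mpdf (s : R) : measurable_fun [set: R] (fun x => (normal_pdf 0 s x)%:E).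
  by apply/measurable_EFinP; exact: measurable_normal_pdf.
rewrite -(Radon_Nikodym_SigmaFinite.change_of_variables numu)//; last first.
  by move=> x; rewrite lee_fin sqr_ge0.
pose s : R := Num.sqrt 2.
have s0 : s != 0%R by rewrite sqrtr_eq0 -ltNge.
have s2 : (s ^+ 2 = 2)%R by rewrite sqr_sqrtr.
pose K : R := (4 * normal_peak 1 / normal_peak s)%R.
have K0 : (0 <= K)%R.
  by rewrite divr_ge0 ?mulr_ge0 ?normal_peak_ge0.
have gpdf : ae_eq mu setT g (fun x => (normal_pdf 0 1 x)%:E).
  apply: (integral_ae_eq measurableT gi (mpdf 1%R)) => E _ mE.
  by rewrite -(Radon_Nikodym_SigmaFinite.f_integral numu).
rewrite (@le_lt_trans _ _ (\int[mu]_x (K%:E * (normal_pdf 0 s x)%:E)))//; last first.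
  rewrite ge0_integralZl//; last 2 first.
    exact: (mpdf s).
    by move=> x _; rewrite lee_fin normal_pdf_ge0.
  by rewrite integral_normal_pdf mule1 ltry.
apply: (@ae_ge0_le_integral _ _ _ mu setT measurableT) => //.
- by move=> x _; rewrite mule_ge0// lee_fin sqr_ge0.
- by apply: emeasurable_funM; [exact: mx2|case/integrableP : gi].
- by move=> x _; rewrite -EFinM lee_fin mulr_ge0// normal_pdf_ge0.
- by apply: emeasurable_funM; [exact: measurable_cst|exact: (mpdf s)].
apply: filterS gpdf => x /(_ Logic.I) gx _; rewrite -/g gx -!EFinM lee_fin.
rewrite !normal_pdfE// ?oner_eq0//.
have e1 : normal_fun 0 1 x = (normal_fun 0 s x * normal_fun 0 s x)%R.
  by rewrite /normal_fun subr0 s2 expr1n -expRD; congr expR; field.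
have xs : (x ^+ 2 * normal_fun 0 s x <= 4)%R.
  have -> : normal_fun 0 s x = (expR (x ^+ 2 / 4))^-1%R.
    by rewrite -expRN /normal_fun subr0 s2; congr expR; field.
  rewrite ler_pdivrMr ?expR_gt0//.
  by have := expR_ge1Dx (x ^+ 2 / 4)%R; lra.
have p1 := normal_peak_ge0 (1 : R).
rewrite /K [leRHS]mulrA divfK ?gt_eqF ?normal_peak_gt0// e1.
rewrite [leLHS](_ : _ = (normal_peak 1 * normal_fun 0 s x) *
  (x ^+ 2 * normal_fun 0 s x))%R; last by ring.
rewrite [leRHS](_ : _ = (normal_peak 1 * normal_fun 0 s x) * 4)%R; last by ring.
by rewrite ler_wpM2l// mulr_ge0// normal_fun_ge0.
Qed.

End normal_second_moment.

Section gaussian_null_sets.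
Local Open Scope ereal_scope.
Context {R : realType} {d du : measure_display} {T : measurableType d}
  {U : measurableType du}.
Variable P : probability T R.
Context {p q : nat}.
Variables (Z : T -> 'M[R]_(p, q)) (W : T -> U).
Local Notation N01 := (normal_prob (0 : R) 1).
Local Notation idx := ('I_p * 'I_q)%type.
Local Notation state := ('M[R]_(p, q) * U)%type.

Hypotheses (mZ : measurable_fun setT Z) (mW : measurable_fun setT W).
Hypothesis ZW : gaussian_indep P Z W.

Lemma entry_second_moment e : \int[P]_w (Z w e.1 e.2 ^+ 2)%:E < +oo.
Proof.
pose V w := (set_entry e 0 (Z w), W w).
have mV : measurable_fun setT V.
  by apply: measurable_fun_pair => //; exact: measurable_set_entry.
pose f (z : R * state) := (z.1 ^+ 2)%:E : \bar R.
have mf : measurable_fun setT f.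
  apply/measurable_EFinP; apply: measurable_funX.
  exact: measurable_fst.
rewrite [ltLHS](_ : _ = \int[P]_w f (Z w e.1 e.2, V w))//.
rewrite (@indep_integral _ _ _ _ (measurableTypeR R) _ _ P
  (fun w => Z w e.1 e.2) V N01 f)//.
- rewrite /f/=; have := normal_second_moment (R := R).
  move: (\int[_]_x _) => c coo; rewrite (_ : \int[P]_w c = c)//.
  rewrite (integral_cst P measurableT c) -[RHS]mule1; congr (_ * _).
  exact: probability_setT.
- exact: measurable_fun_entry.
- by move=> A B mA mB; exact: entry_indep.
- by move=> z; rewrite lee_fin sqr_ge0.
Qed.

(** The zero set lies in the window of every half-width t, of probability at most 2 t times the peak
    of the density. *)
Lemma affine_entry_neq0 e (b : state -> R) :
  measurable_fun setT b -> insensitive e b ->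
  {ae P, forall w, (Z w e.1 e.2 + b (Z w, W w) != 0)%R}.
Proof.
move=> mb be; set N := [set w | (Z w e.1 e.2 + b (Z w, W w) = 0)%R].
have mN : measurable N.
  rewrite (_ : N = (fun w => Z w e.1 e.2 + b (Z w, W w))%R @^-1` [set 0%R])//.
  rewrite -[X in measurable X]setTI.
  have : measurable_fun setT (fun w => Z w e.1 e.2 + b (Z w, W w))%R.
    apply: measurable_funD; first exact: measurable_fun_entry.
    by apply: (measurableT_comp mb); exact: measurable_state.
  by apply => //; exact: measurable_set1.
exists N; split => //; last by move=> w /= /negP; rewrite negbK => /eqP.
apply/eqP; rewrite eq_le measure_ge0 andbT.
apply/lee_addgt0Pr => eps eps0; rewrite add0e.
have peak0 : (0 < normal_peak (1 : R))%R by rewrite normal_peak_gt0 ?oner_eq0.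
pose t := (eps / (normal_peak 1 * 2))%R.
have t0 : (0 <= t)%R by rewrite divr_ge0 ?mulr_ge0// ltW.
have -> : P N = \int[P]_w (\1_N w)%:E by rewrite integral_indic ?setIT.
have mZb : measurable_fun setT (fun w => Z w e.1 e.2 + b (Z w, W w))%R.
  apply: measurable_funD; first exact: measurable_fun_entry.
  by apply: (measurableT_comp mb); exact: measurable_state.
rewrite (@le_trans _ _ (\int[P]_w (1 * window t (Z w e.1 e.2 + b (Z w, W w))%R)))//.
  apply: nonneg_le_integral => w; first by rewrite lee_fin.
  rewrite mul1e indicE lee_fin.
  case: (boolP (w \in N)) => //; rewrite inE => Nw.
  by rewrite Nw normr0 t0.
rewrite (@window_integral1 _ _ _ _ _ _ _ _ _ _ mZ mW ZW e (cst 1) b t)//.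
apply: (@le_trans _ _ (\int[P]_w (cst eps%:E w))).
  apply: nonneg_le_integral => w; first by rewrite mul1e window_mass_ge0.
  rewrite mul1e.
  rewrite (le_trans (window_mass_ub _ t0))// lee_fin /t.
  by rewrite mulrA mulrC divfK// mulf_neq0// gt_eqF.
rewrite integral_cst// -[leRHS]mule1 lee_wpmul2l//.
  by rewrite lee_fin ltW.
exact: probability_le1.
Qed.

End gaussian_null_sets.

Section gaussian_full_rank.
Context {R : realType} {d : measure_display} {T : measurableType d}.
Variable P : probability T R.

(** The determinant is affine in its corner entry, and its slope, a minor of size one less, is
    almost surely nonzero by induction. *)
Lemma gaussian_minor_neq0 {m p k : nat} (Z : T -> 'M[R]_(m, p))
    (f : 'I_k -> 'I_m) (g : 'I_k -> 'I_p) :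
  measurable_fun setT Z -> gaussian_indep P Z (fun=> tt) ->
  injective f -> injective g ->
  {ae P, forall w, \det (mxsub f g (Z w)) != 0}.
Proof.
move=> mZ ZW; elim: k f g => [|k ih] f g fI gI.
  by apply: aeW => w; rewrite det_mx00 oner_eq0.
pose M (z : 'M[R]_(m, p) * unit) := mxsub f g z.1.
pose rest z := \sum_(j | j != ord0) M z ord0 j * cofactor (M z) ord0 j.
(* Where the cofactor is 0 the inverse takes its default value 0; the induction hypothesis discards
   these points. *)
pose b z := rest z * (cofactor (M z) ord0 ord0)^-1.
have mM : measurable_fun setT M.
  by apply: measurable_fun_mxsub; exact: measurable_fst.
have mcof i j : measurable_fun setT (fun z => cofactor (M z) i j).
  apply: measurable_funM => //; apply: measurable_fun_det.
  apply: measurable_fun_mx => a c; under eq_fun do rewrite !mxE.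
  by apply: measurable_fun_entry; exact: measurable_fst.
have mb : measurable_fun setT b.
  apply: measurable_funM.
    rewrite /rest; under eq_fun do rewrite big_mkcond.
    apply: measurable_sum => j; case: (j != ord0) => //.
    by apply: measurable_funM => //; exact: measurable_fun_entry.
  exact: (measurableT_comp measurable_inv (mcof ord0 ord0)).
have cofE x N u j : cofactor (M (set_entry (f ord0, g ord0) x N, u)) ord0 j =
    cofactor (M (N, u)) ord0 j.
  congr (_ * \det _); apply/matrixP => a c; rewrite !mxE ifF//.
  by apply/eqP => -[/fI] /eqP; rewrite eq_sym (negbTE (neq_lift _ _)).
have be : insensitive (f ord0, g ord0) b.
  move=> x N u; rewrite /b cofE; congr (_ * _).
  apply: eq_bigr => j j0; rewrite cofE !mxE ifF//.
  by apply/eqP => -[/gI] /eqP; rewrite (negbTE j0).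
have := affine_entry_neq0 mZ (measurable_cst tt) ZW mb be.
have fI' : injective (f \o lift ord0) by move=> i j /fI /lift_inj.
have gI' : injective (g \o lift ord0) by move=> i j /gI /lift_inj.
apply: filterS2 (ih _ _ fI' gI') => w /= cof0.
apply: contra_neq => det0.
have c00 : cofactor (M (Z w, tt)) ord0 ord0 != 0.
  rewrite /cofactor/= expr0 mul1r; move: cof0; congr (\det _ != _).
  by apply/matrixP => a c; rewrite !mxE.
apply: (mulIf c00); rewrite mul0r mulrDl /b divfK//.
rewrite -[RHS]det0 (expand_det_row _ ord0) (bigD1 ord0)//=.
by rewrite /rest /M !mxE.
Qed.

Lemma gaussian_full_rank {m p : nat} (Z : T -> 'M[R]_(m, p)) :
  measurable_fun setT Z -> gaussian_indep P Z (fun=> tt) ->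
  {ae P, forall w, \rank (Z w) = minn m p}.
Proof.
move=> mZ ZW.
have wI (a c : nat) (ac : (a <= c)%N) : injective (widen_ord ac).
  by move=> i j /(congr1 val)/= /val_inj.
have := @gaussian_minor_neq0 _ _ _ Z (widen_ord (geq_minl m p))
  (widen_ord (geq_minr m p)) mZ ZW (wI _ _ _) (wI _ _ _).
apply: filterS => w; rewrite -unitfE -unitmxE => /mxrank_unit rk.
apply/eqP; rewrite eqn_leq leq_min rank_leq_row rank_leq_col/= -{1}rk.
rewrite mxsubrc (leq_trans (mxrankS (rowsub_sub _ _)))//.
by rewrite -mxrank_tr trmx_mxsub (leq_trans (mxrankS (rowsub_sub _ _)))// mxrank_tr.
Qed.

End gaussian_full_rank.

(** * The inverse of the statistic F *)

Section dyadic_windows.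
Context {R : realType}.
Local Notation half l := (2^-1 ^+ l : R).

Lemma window_prod (I : eqType) (L : seq I) (y : I -> R) (t : R) :
  (\prod_(i <- L) window t (y i))%E = (all (fun i => `|y i| <= t) L)%:R%:E.
Proof.
elim: L => [|i L ih]; first by rewrite big_nil.
by rewrite big_cons ih /window /= -EFinM -natrM mulnb.
Qed.

Lemma dyadic_scale (rho : R) : 0 < rho <= 1 ->
  exists l : nat, 4^-1 ^+ l.+1 < rho <= 4^-1 ^+ l.
Proof.
move=> /andP[rho0 rho1].
have ex : exists l : nat, 4^-1 ^+ l < rho.
  have [n nrho] : exists n : nat, rho^-1 < n%:R.
    by exists (Num.truncn rho^-1).+1; rewrite truncnS_gt.
  exists n; rewrite exprVn invf_plt ?posrE ?exprn_gt0//.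
  rewrite (lt_le_trans nrho)// -natrX ler_nat.
  by apply: ltnW; apply: ltn_expl.
case: (ex_minnP ex) => -[|l] lrho lmin.
  by move: lrho; rewrite expr0 ltNge rho1.
exists l; rewrite lrho/= leNgt; apply/negP => /lmin.
by rewrite ltnn.
Qed.

(** One term suffices: if 4^-(l+1) < rho <= 4^-l, all windows at scale l are hit and 4 * 4^l exceeds
    1/rho. The summand 1 covers rho >= 1. *)
Lemma inv_le_dyadic (I : eqType) (L : seq I) (y : I -> R) (rho : R) :
  0 < rho -> (forall i, y i ^+ 2 <= rho) ->
  ((rho^-1)%:E <= 1 + 4%:E * \sum_(l <oo) ((4 ^+ l)%:E *
    \prod_(i <- L) window (half l) (y i)))%E.
Proof.
move=> rho0 yrho.
pose u l : \bar R := ((4 ^+ l)%:E * \prod_(i <- L) window (half l) (y i))%E.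
have u0 l : (0 <= u l)%E.
  by rewrite /u window_prod -EFinM lee_fin mulr_ge0// exprn_ge0.
have s0 : (0 <= \sum_(l <oo) u l)%E by apply: nneseries_ge0 => l _ _.
have [rho1|rho1] := leP 1 rho.
  rewrite (@le_trans _ _ 1%E)//; first by rewrite lee_fin invf_le1.
  by rewrite leeDl// mule_ge0.
have [l /andP[rl lr]] := dyadic_scale (introT andP (conj rho0 (ltW rho1))).
rewrite (@le_trans _ _ (4%:E * u l)%E)//; last first.
  rewrite (@le_trans _ _ (4%:E * \sum_(l <oo) u l)%E)//.
    rewrite lee_pmul2l//.
    rewrite (@nneseriesD1 _ _ l xpredT)//.
    by rewrite leeDl//; apply: nneseries_ge0 => k _ _.
  by rewrite leeDr.
rewrite /u window_prod (_ : all _ _ = true).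
  rewrite mule1 -EFinM lee_fin -exprS ltW// invf_plt ?posrE ?exprn_gt0//.
  by rewrite -exprVn.
apply/allP => i _; rewrite -ler_sqr ?nnegrE ?exprn_ge0//.
rewrite real_normK ?num_real// (le_trans (yrho i))// (le_trans lr)//.
by rewrite -exprM mulnC exprM expr2 -invfM -natrM.
Qed.

(** The powers of 4 up to [B] add up to at most 4/3 of the largest one. *)
Lemma geometric_threshold (B : R) (N : nat) : 0 <= B ->
  \sum_(l < N) (4 ^+ l <= B)%R%:R * 4 ^+ l <= 4 / 3 * B.
Proof.
move=> B0; elim: N => [|N ih]; first by rewrite big_ord0 mulr_ge0// divr_ge0.
rewrite big_ord_recr/=; have [NB|NB] := leP (4 ^+ N) B; last first.
  by rewrite mul0r addr0.
have S M : \sum_(l < M) (4 ^+ l <= B)%R%:R * 4 ^+ l <= (4 ^+ M - 1) / 3 :> R.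
  elim: M => [|M ihM]; first by rewrite big_ord0 expr0 subrr mul0r.
  rewrite big_ord_recr/= (@le_trans _ _ ((4 ^+ M - 1) / 3 + 4 ^+ M))//.
    rewrite lerD// ler_piMl ?exprn_ge0//.
    by rewrite (ler_nat R _ 1) leq_b1.
  by rewrite exprS; lra.
by have := S N; rewrite mul1r; lra.
Qed.

Lemma dyadic_le_inv (I : finType) (y : I -> R) (N : nat) : (#|I| <= 2)%N ->
  0 < \sum_i y i ^+ 2 ->
  \sum_(l < N) 4 ^+ l * (all (fun i => `|y i| <= half l) (enum I))%:R <=
  3 / \sum_i y i ^+ 2.
Proof.
move=> I2; set rho := \sum_i _ => rho0.
(* At most two entries inside the window of scale l force rho <= 2 * 4^-l, that is 4^l <= 2 / rho;
   the constant 8/3 is rounded up to 3. *)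
apply: (@le_trans _ _ (4 / 3 * (2 / rho))); last first.
  by rewrite mulrA ler_pM2r ?invr_gt0//; lra.
apply: le_trans (geometric_threshold N _); last by rewrite divr_ge0// ltW.
apply: ler_sum => l _; rewrite mulrC ler_wpM2r ?exprn_ge0//.
case: allP => // yl; rewrite (_ : (4 ^+ l <= 2 / rho) = true)//.
rewrite ler_pdivlMr// mulrC -ler_pdivlMr ?exprn_gt0//.
apply: (@le_trans _ _ (\sum_(i : I) 4^-1 ^+ l)).
  apply: ler_sum => i _; rewrite -real_normK ?num_real//.
  have := yl i; rewrite mem_enum => /(_ isT) yil.
  apply: (@le_trans _ _ (half l ^+ 2)); first by rewrite ler_sqr ?nnegrE ?exprn_ge0.
  by rewrite -exprM mulnC exprM expr2 -invfM -natrM.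
rewrite sumr_const -[_ *+ #|_|]mulr_natl exprVn ler_pM2r ?invr_gt0 ?exprn_gt0//.
by rewrite ler_nat.
Qed.

End dyadic_windows.

Section minor_windows.
Context {R : realType} {p q k : nat}.
Variables (A : 'M[R]_p) (theta : 'M[R]_(p, q)).
Hypothesis uA : A \in unitmx.
Local Notation state := ('M[R]_(p, q) * 'M[R]_p)%type.
Implicit Types (f : 'I_k -> 'I_p) (ij : 'I_k * 'I_q).

Definition minor_entry f ij : 'I_p * 'I_q := (f ij.1, ij.2).

(** The identity block of [minor_coef] in the columns [f] makes entry (i, j) of U X equal to entry
    (f i, j) of A^-1 (X - theta) plus this quantity, which involves only rows outside the range of
    [f]. *)
Definition minor_shift f ij (s : state) : R :=
  \sum_(l | l \notin codom f) minor_coef A f s.2 ij.1 l * s.1 l ij.2 +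
  (minor_coef A f s.2 *m (invmx A *m theta)) ij.1 ij.2.

Definition minor_value f ij (s : state) : R :=
  s.1 (minor_entry f ij).1 (minor_entry f ij).2 + minor_shift f ij s.

Lemma minor_coef_diag f S i j : minor_gram A f S \in unitmx ->
  minor_coef A f S i (f j) = (i == j)%:R.
Proof.
move=> /(colsub_minor_coef) /matrixP/(_ i j).
by rewrite !mxE.
Qed.

Lemma minor_gram_inj f S : minor_gram A f S \in unitmx -> injective f.
Proof.
move=> uG i j fij; apply/eqP; have := minor_coef_diag i i uG.
rewrite eqxx fij minor_coef_diag//; case: eqP => // _ /eqP.
by rewrite eq_sym oner_eq0.
Qed.

Lemma minor_entry_inj f : injective f -> injective (minor_entry f).
Proof. by move=> fI [i j] [i' j'] [/fI -> ->]. Qed.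

Lemma minor_valueE f S (X : 'M[R]_(p, q)) ij : minor_gram A f S \in unitmx ->
  (minor_coef A f S *m invmx A *m X) ij.1 ij.2 =
  minor_value f ij (invmx A *m (X - theta), S).
Proof.
move=> uG; set z := invmx A *m _; case: ij => i j /=.
have fI := minor_gram_inj uG.
have XE : invmx A *m X = z + invmx A *m theta by rewrite /z mulmxBr subrK.
rewrite -mulmxA XE mulmxDr mxE /minor_value /minor_shift addrA/=.
congr (_ + _); rewrite mxE (bigID (mem (codom f)))/=; congr (_ + _).
rewrite (bigD1 (f i)) ?codom_f//= minor_coef_diag// eqxx mul1r.
rewrite big1 ?addr0// => l /andP[/codomP[i' ->] fi'i].
rewrite minor_coef_diag// (_ : (i == i') = false) ?mul0r//.
by apply: contraNF fi'i => /eqP ->.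
Qed.

Lemma minor_shift_insensitive f ij ij' :
  insensitive (minor_entry f ij) (minor_shift f ij').
Proof.
move=> x M S; rewrite /minor_shift/=; congr (_ + _).
apply: eq_bigr => l lf; rewrite [set_entry _ _ _ _ _]mxE ifF//.
by apply: contraNF lf => /eqP[-> _]; exact: codom_f.
Qed.

Let measurable_form {d : measure_display} {T : measurableType d} (g : T -> 'M[R]_p) :
  measurable_fun setT g ->
  measurable_fun setT (fun s => A^T *m g s *m A).
Proof.
move=> mg; apply: measurable_fun_mulmx; last exact: measurable_cst.
by apply: measurable_fun_mulmx => //; exact: measurable_cst.
Qed.

Lemma measurable_minor_gram {d : measure_display} {T : measurableType d} f
    (g : T -> 'M[R]_p) : measurable_fun setT g ->
  measurable_fun setT (fun s => minor_gram A f (g s)).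
Proof. by move=> mg; apply: measurable_fun_mxsub; exact: measurable_form. Qed.

Lemma measurable_minor_coef {d : measure_display} {T : measurableType d} f
    (g : T -> 'M[R]_p) : measurable_fun setT g ->
  measurable_fun setT (fun s => minor_coef A f (g s)).
Proof.
move=> mg; apply: measurable_fun_mulmx.
  by apply: measurable_fun_adjinv; exact: measurable_minor_gram.
by apply: measurable_fun_mxsub; exact: measurable_form.
Qed.

Lemma measurable_minor_weight {d : measure_display} {T : measurableType d} f
    (g : T -> 'M[R]_p) : measurable_fun setT g ->
  measurable_fun setT (fun s => minor_weight A f (g s)).
Proof.
move=> mg; rewrite /minor_weight; apply: measurable_fun_mxtrace.
have mU : measurable_fun setT (fun s => minor_coef A f (g s) *m invmx A).
  apply: measurable_fun_mulmx; last exact: measurable_cst.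
  exact: measurable_minor_coef.
have mUU : measurable_fun setT (fun s => adjinv
    ((minor_coef A f (g s) *m invmx A) *m (minor_coef A f (g s) *m invmx A)^T)).
  apply: measurable_fun_adjinv; apply: measurable_fun_mulmx => //.
  exact: measurable_fun_trmx.
apply: measurable_fun_mulmx => //; apply: measurable_fun_mulmx => //.
by apply: measurable_fun_adjinv; exact: measurable_minor_gram.
Qed.

Lemma measurable_minor_shift f ij : measurable_fun setT (minor_shift f ij).
Proof.
have mV : measurable_fun setT (fun s : state => minor_coef A f s.2).
  by apply: measurable_minor_coef; exact: measurable_snd.
apply: measurable_funD.
  under eq_fun do rewrite big_mkcond.
  apply: measurable_sum => l; case: (l \notin codom f) => //.
  apply: measurable_funM; first exact: measurable_fun_entry.
  by apply: measurable_fun_entry; exact: measurable_fst.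
by apply: measurable_fun_entry; exact: measurable_fun_mulmx.
Qed.

Lemma measurable_minor_unit {d : measure_display} {T : measurableType d} f
    (g : T -> 'M[R]_p) : measurable_fun setT g ->
  measurable_fun setT (fun s => (minor_gram A f (g s) \in unitmx : bool)).
Proof.
move=> mg; under eq_fun do rewrite unitmxE unitfE.
rewrite (_ : (fun _ => _) = (fun s => ~~ (\det (minor_gram A f (g s)) == 0))).
  apply: measurable_neg; apply: measurable_fun_eqr; last exact: measurable_cst.
  by apply: measurable_fun_det; exact: measurable_minor_gram.
by [].
Qed.

Lemma fnorm2_minor_value f S (X : 'M[R]_(p, q)) :
  minor_gram A f S \in unitmx ->
  fnorm2 (minor_coef A f S *m invmx A *m X) =
  \sum_ij minor_value f ij (invmx A *m (X - theta), S) ^+ 2.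
Proof.
move=> uG; rewrite /fnorm2 pair_bigA/=; apply: eq_bigr => ij _.
by rewrite minor_valueE.
Qed.

End minor_windows.

Section inverse_statistic.
Context {R : realType} {d : measure_display} {T : measurableType d}.
Variable P : probability T R.
Context {m p q k : nat}.
Variables (A : 'M[R]_p) (theta : 'M[R]_(p, q)).
Variables (X : T -> 'M[R]_(p, q)) (Y : T -> 'M[R]_(m, p)).
Hypothesis uA : A \in unitmx.
Hypotheses (mX : measurable_fun setT X) (mY : measurable_fun setT Y).
Let z w := invmx A *m (X w - theta).
Let S w := gram (Y w).
Hypothesis zS : gaussian_indep P z S.
Hypothesis rankY : {ae P, forall w, \rank (Y w) = k}.
Hypotheses (k_gt0 : (0 < k)%N) (q_gt0 : (0 < q)%N).
Local Notation F w := (stat_F (X w) (S w)).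
Local Notation state := ('M[R]_(p, q) * 'M[R]_p)%type.
Local Notation value f ij w := (minor_value A theta f ij (z w, S w)).
Local Notation half l := (2^-1 ^+ l : R).

Let mz : measurable_fun setT z.
Proof.
apply: measurable_fun_mulmx => //.
apply: measurable_fun_mx => i j; under eq_fun do rewrite !mxE.
by apply: measurable_funB => //; exact: measurable_fun_entry.
Qed.

Let mS : measurable_fun setT S.
Proof. by apply: measurable_fun_mulmx => //; exact: measurable_fun_trmx. Qed.

Let stat_lower w : \rank (Y w) = k -> exists f : {ffun 'I_k -> 'I_p},
  minor_gram A f (S w) \in unitmx /\
  \sum_ij value f ij w ^+ 2 <=
  (k * p)%:R * fnorm2 (invmx A) * \tr (S w) * F w.
Proof.
move=> rY; have [f [uG lowF]] := @stat_F_lower R m p q k A uA (Y w) rY.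
by exists f; split=> //; rewrite -fnorm2_minor_value.
Qed.

Let trS_ge0 w : 0 <= \tr (S w).
Proof. by rewrite -[S w]/((Y w)^T *m Y w) -{2}[Y w]trmxK -fnorm2_trace fnorm2_ge0. Qed.

Let F_ge0 w : 0 <= F w.
Proof. by rewrite stat_F_fnorm2 fnorm2_ge0. Qed.

Lemma minor_value_neq0 : {ae P, forall w, forall (f : {ffun 'I_k -> 'I_p}) ij,
  value f ij w != 0}.
Proof.
apply: filter_forall => f; apply: filter_forall => ij.
apply: (affine_entry_neq0 mz mS zS (measurable_minor_shift A theta f ij)).
exact: minor_shift_insensitive.
Qed.

Lemma stat_F_neq0 : {ae P, forall w, F w != 0}.
Proof.
apply: filterS2 rankY minor_value_neq0 => w rY val0.
have [f [uG lowF]] := stat_lower rY.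
apply/negP => /eqP F0; move: lowF; rewrite F0 mulr0 => sum_le0.
have /negP[] := val0 f (Ordinal k_gt0, Ordinal q_gt0).
rewrite -sqrf_eq0 eq_le sqr_ge0 andbT (le_trans _ sum_le0)//.
rewrite (bigD1 (Ordinal k_gt0, Ordinal q_gt0))//= lerDl.
by apply: sumr_ge0 => ij _; exact: sqr_ge0.
Qed.

(** Vanishing at singular minors keeps only useful [f] in sums over all choices; the absolute value
    gives a sign also at states whose second component is not a Gram matrix. The same holds for
    [inverse_weight]. *)
Definition trace_weight (f : 'I_k -> 'I_p) (s : state) : R :=
  if minor_gram A f s.2 \in unitmx then `|\tr s.2| else 0.

Definition inverse_weight (f : 'I_k -> 'I_p) (s : state) : R :=
  if minor_gram A f s.2 \in unitmx then `|minor_weight A f s.2|^-1 else 0.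

Let measurable_trace_weight f : measurable_fun setT (trace_weight f).
Proof.
apply: measurable_fun_ifT => //.
- by apply: measurable_minor_unit; exact: measurable_snd.
- apply: measurableT_comp => //; apply: measurable_fun_mxtrace.
  exact: measurable_snd.
Qed.

Let measurable_inverse_weight f : measurable_fun setT (inverse_weight f).
Proof.
apply: measurable_fun_ifT => //.
- by apply: measurable_minor_unit; exact: measurable_snd.
- have mw : measurable_fun setT (fun s : state => `|minor_weight A f s.2|).
    apply: measurableT_comp => //.
    by apply: measurable_minor_weight; exact: measurable_snd.
  exact: (measurableT_comp measurable_inv mw).
Qed.

Let measurable_zS : measurable_fun setT (fun w => (z w, S w)).
Proof. exact: measurable_fun_pair. Qed.

Let measurable_value (f : 'I_k -> 'I_p) ij :
  measurable_fun setT (fun w => value f ij w).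
Proof.
apply: measurable_funD; first exact: measurable_fun_entry.
exact: (measurableT_comp (measurable_minor_shift A theta f ij) measurable_zS).
Qed.

Let measurable_window_prod (f : 'I_k -> 'I_p) t (L : seq ('I_k * 'I_q)) :
  measurable_fun setT (fun w => (\prod_(ij <- L) window t (value f ij w))%E).
Proof.
elim: L => [|ij L ihL].
  by under eq_fun do rewrite big_nil; exact: measurable_cst.
under eq_fun do rewrite big_cons.
apply: emeasurable_funM => //.
exact: (measurableT_comp (measurable_window t)).
Qed.

Let value_integral (f : 'I_k -> 'I_p) (g : state -> R) t (L : seq ('I_k * 'I_q)) :
  injective f -> uniq L -> measurable_fun setT g -> (forall s, 0 <= g s) ->
  (forall e, insensitive e g) ->
  (\int[P]_w ((g (z w, S w))%:E * \prod_(ij <- L) window t (value f ij w)) =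
   \int[P]_w ((g (z w, S w))%:E *
     \prod_(ij <- L) window_mass t (minor_shift A theta f ij (z w, S w))))%E.
Proof.
move=> fI uL mg g0 ginv.
apply: (window_integral mz mS zS (g := fun s => (g s)%:E)
  (b := minor_shift A theta f) t (minor_entry_inj fI) uL).
- exact/measurable_EFinP.
- by move=> s; rewrite lee_fin.
- by move=> e x M s; rewrite ginv.
- by move=> ij; exact: measurable_minor_shift.
- by move=> ij ij'; exact: minor_shift_insensitive.
Qed.

Local Open Scope ereal_scope.

Let half_ge0 l : (0 <= half l)%R. Proof. exact: exprn_ge0. Qed.

Let upper_term (f : 'I_k -> 'I_p) (L : seq ('I_k * 'I_q)) (l : nat) w : \bar R :=
  (4 * 4 ^+ l)%:E * ((trace_weight f (z w, S w))%:E *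
    \prod_(ij <- L) window (half l) (value f ij w)).

Let upper_term_ge0 f L l w : 0 <= upper_term f L l w.
Proof.
rewrite /upper_term window_prod -!EFinM lee_fin !mulr_ge0 ?exprn_ge0//.
by rewrite /trace_weight; case: ifP.
Qed.

Let measurable_upper_term f L l : measurable_fun setT (upper_term f L l).
Proof.
apply: emeasurable_funM => //; apply: emeasurable_funM => //.
apply/measurable_EFinP.
exact: (measurableT_comp (measurable_trace_weight f) measurable_zS).
Qed.

Let trace_weight_ge0 f s : (0 <= trace_weight f s)%R.
Proof. by rewrite /trace_weight; case: ifP. Qed.

(* Three windows of width of order 2^-l have mass of order 8^-l, against the
   factor 4^l. *)
Let upper_term_integral (f : 'I_k -> 'I_p) L l : injective f -> uniq L ->
  size L = 3%N ->
  \int[P]_w upper_term f L l w <=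
  ((4 * (normal_peak 1 * 2) ^+ 3) / 2 ^+ l)%:E * \int[P]_w (\tr (S w))%:E.
Proof.
move=> fI uL sL.
have mtS : measurable_fun setT (fun w => (\tr (S w))%:E).
  by apply/measurable_EFinP; exact: measurable_fun_mxtrace.
have mtw : measurable_fun setT (fun w => (trace_weight f (z w, S w))%:E).
  apply/measurable_EFinP.
  exact: (measurableT_comp (measurable_trace_weight f) measurable_zS).
have k4 : 0 <= (4 * 4 ^+ l)%:E :> \bar R by rewrite lee_fin mulr_ge0// exprn_ge0.
rewrite /upper_term ge0_integralZl//; last 2 first.
- exact: emeasurable_funM.
- by move=> w _; rewrite window_prod -EFinM lee_fin mulr_ge0.
rewrite value_integral//.
pose c : R := ((normal_peak 1 * (2 * half l)) ^+ 3)%R.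
have c0 : (0 <= c)%R by rewrite exprn_ge0// !mulr_ge0 ?normal_peak_ge0.
have massL w : \prod_(ij <- L) window_mass (half l)
    (minor_shift A theta f ij (z w, S w)) <= c%:E.
  rewrite /c -sL; elim: (L) => [|ij L' ihL]; first by rewrite big_nil.
  rewrite big_cons exprS EFinM lee_pmul ?window_mass_ge0//.
    by apply: prode_ge0 => ij' _; exact: window_mass_ge0.
  exact: window_mass_ub.
apply: (@le_trans _ _ ((4 * 4 ^+ l)%:E * (c%:E * \int[P]_w (\tr (S w))%:E))).
  rewrite lee_wpmul2l ?lee_fin ?mulr_ge0 ?exprn_ge0//.
  rewrite -ge0_integralZl//; last by move=> w _; rewrite lee_fin.
  apply: nonneg_le_integral => w.
    rewrite mule_ge0 ?lee_fin//.
    by apply: prode_ge0 => ij' _; exact: window_mass_ge0.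
  rewrite muleC lee_pmul ?lee_fin//.
  - by apply: prode_ge0 => ij' _; exact: window_mass_ge0.
  - by rewrite /trace_weight/=; case: ifP => // _; rewrite ger0_norm.
rewrite muleA -EFinM (_ : (4 * 4 ^+ l * c)%R =
    ((4 * (normal_peak 1 * 2) ^+ 3) / 2 ^+ l)%R)//.
have h8 : (half l ^+ 3 = (4 ^+ l)^-1 * (2 ^+ l)^-1)%R.
  by rewrite -exprM mulnC exprM -!exprVn -exprMn; congr (_ ^+ l)%R; field.
have -> : (4 * 4 ^+ l * c = 4 * 4 ^+ l * (normal_peak 1 * 2) ^+ 3 * half l ^+ 3)%R.
  by rewrite /c; ring.
rewrite h8.
have : (4 ^+ l != 0 :> R)%R by rewrite expf_neq0.
have : (2 ^+ l != 0 :> R)%R by rewrite expf_neq0.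
by move: (4 ^+ l)%R (2 ^+ l)%R => a b b0 a0; field; rewrite a0 b0.
Qed.

(** A measurable majorant with finite integral serves as well as a bound on the integral of 1/F and
    avoids the measurability of F. *)
Lemma inverse_statF_upper : (2 < k * q)%N ->
  \int[P]_w (\tr (S w))%:E < +oo ->
  exists G : T -> \bar R, [/\ measurable_fun setT G, forall w, 0 <= G w,
    {ae P, forall w, ((F w)^-1)%:E <= G w} & \int[P]_w G w < +oo].
Proof.
move=> kq trS_fin.
pose L : seq ('I_k * 'I_q) := take 3 (enum {: 'I_k * 'I_q}).
have uL : uniq L by rewrite take_uniq// enum_uniq.
have sL : size L = 3%N.
  by rewrite size_takel// -cardE card_prod !card_ord.
pose K : R := ((k * p)%:R * fnorm2 (invmx A))%R.
have K0 : (0 <= K)%R by rewrite mulr_ge0// fnorm2_ge0.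
pose H (f : {ffun 'I_k -> 'I_p}) w := (trace_weight f (z w, S w))%:E +
  \sum_(l <oo) upper_term f L l w.
have H0 f w : 0 <= H f w.
  by rewrite adde_ge0 ?lee_fin//; apply: nneseries_ge0.
have mtw f : measurable_fun setT (fun w => (trace_weight f (z w, S w))%:E).
  apply/measurable_EFinP.
  exact: (measurableT_comp (measurable_trace_weight f) measurable_zS).
have msum f : measurable_fun setT (fun w => \sum_(l <oo) upper_term f L l w).
  exact: ge0_emeasurable_sum.
have mH f : measurable_fun setT (H f) by exact: emeasurable_funD.
have mtS : measurable_fun setT (fun w => (\tr (S w))%:E).
  by apply/measurable_EFinP; exact: measurable_fun_mxtrace.
have itS : \int[P]_w (\tr (S w))%:E \is a fin_num.
  by rewrite ge0_fin_numE// integral_ge0// => w _; rewrite lee_fin.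
have iH f : \int[P]_w H f w < +oo.
  (* A repeated column makes the minor singular, so the weight of such an [f] vanishes
     identically. *)
  have [fI|nfI] := pselect (injective f); last first.
    rewrite integral0_eq// => w _; rewrite /H.
    have t0 : trace_weight f (z w, S w) = 0%R.
      by rewrite /trace_weight; case: ifPn => // /minor_gram_inj.
    rewrite t0 add0e eseries0// => l _ _.
    by rewrite /upper_term t0 mul0e mule0.
  rewrite ge0_integralD//; last 2 first.
    by move=> w _; rewrite lee_fin.
    by move=> w _; exact: nneseries_ge0.
  rewrite lte_add_pinfty//.
    apply: le_lt_trans trS_fin; apply: nonneg_le_integral => w.
      by rewrite lee_fin.
    by rewrite lee_fin /trace_weight/=; case: ifP => // _; rewrite ger0_norm.
  rewrite integral_nneseries//.
  (* Twice the constant of [upper_term_integral], because the geometric series used has exponents l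
     + 1. *)
  pose C : R := (2 * ((4 * (normal_peak 1 * 2) ^+ 3) *
    fine (\int[P]_w (\tr (S w))%:E)))%R.
  have half_sum : \sum_(l <oo) (C / (2 ^ (l + 1))%:R)%:E = (C / 2 ^+ 0)%:E.
    by apply: cvg_lim => //; exact: (@cvg_geometric_eseries_half R C 0).
  apply: (@le_lt_trans _ _ (\sum_(l <oo) (C / (2 ^ (l + 1))%:R)%:E)); last first.
    by rewrite half_sum ltry.
  apply: lee_nneseries => [l _ _|l _]; first exact: integral_ge0.
  rewrite (le_trans (upper_term_integral l fI uL sL))//.
  rewrite -{1}(fineK itS) -EFinM lee_fin /C natrX addn1 [(2 ^+ l.+1)%R]exprS.
  have : (2 ^+ l != 0 :> R)%R by rewrite expf_neq0.
  move: (2 ^+ l)%R => a a0; rewrite le_eqVlt; apply/orP; left; apply/eqP.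
  by field.
(* The good choice of columns varies with [w]; the sum over all choices dominates it. *)
exists (fun w => K%:E * \sum_(f : {ffun 'I_k -> 'I_p}) H f w); split.
- by apply: emeasurable_funM => //; exact: emeasurable_sum.
- by move=> w; rewrite mule_ge0// sume_ge0.
- apply: filterS3 rankY stat_F_neq0 minor_value_neq0 => w rY F0 val0.
  have Fp : (0 < F w)%R by rewrite lt0r F0 F_ge0.
  have [f [uG]] := stat_lower rY; rewrite -/K.
  set rho := (\sum_ij _)%R => rhoF.
  have rho0 : (0 < rho)%R.
    rewrite /rho (bigD1 (Ordinal k_gt0, Ordinal q_gt0))//= ltr_pwDl//.
      by rewrite lt0r sqrf_eq0 val0 sqr_ge0.
    by apply: sumr_ge0 => ij _; exact: sqr_ge0.
  have valrho ij : (value f ij w ^+ 2 <= rho)%R.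
    by rewrite /rho (bigD1 ij)//= lerDl sumr_ge0// => ij' _; exact: sqr_ge0.
  apply: (@le_trans _ _ (K%:E * H f w)); last first.
    rewrite lee_wpmul2l// (bigD1 f)//= leeDl// sume_ge0//.
  have twE : trace_weight f (z w, S w) = \tr (S w).
    by rewrite /trace_weight uG/= ger0_norm.
  have HE : H f w = (\tr (S w))%:E * (1 + 4%:E * \sum_(l <oo) ((4 ^+ l)%:E *
      \prod_(ij <- L) window (half l) (value f ij w))).
    have u0 l : 0 <= (4 ^+ l)%:E *
        \prod_(ij <- L) window (half l) (value f ij w).
      by rewrite window_prod -EFinM lee_fin mulr_ge0// exprn_ge0.
    rewrite muleDr ?ge0_adde_def ?inE ?mule_ge0 ?nneseries_ge0// mule1.
    rewrite -nneseriesZl// -nneseriesZl//.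
      rewrite /H twE; congr (_ + _); apply: eq_eseriesr => l _.
      rewrite /upper_term twE !muleA; congr (_ * _); rewrite -!EFinM.
      by congr EFin; ring.
    by move=> l _; rewrite mule_ge0.
  rewrite HE muleA -EFinM.
  apply: (@le_trans _ _ ((K * \tr (S w))%:E * (rho^-1)%:E)).
    by rewrite -EFinM lee_fin ler_pdivlMr// mulrC ler_pdivrMr.
  rewrite lee_wpmul2l ?lee_fin ?mulr_ge0 ?fnorm2_ge0//.
  exact: (inv_le_dyadic L rho0 valrho).
- rewrite ge0_integralZl//.
  + rewrite ge0_integral_sum// lte_mul_pinfty ?lee_fin//.
    by apply: lte_sum_pinfty => f _; exact: iH.
  + exact: emeasurable_sum.
  + by move=> w _; exact: sume_ge0.
Qed.

Let inverse_weight_ge0 f s : (0 <= inverse_weight f s)%R.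
Proof. by rewrite /inverse_weight; case: ifP => // _; rewrite invr_ge0. Qed.

(** Truncated to [N] scales; the factor 1/3 offsets the constant of [dyadic_le_inv], so that 1/F
    dominates it. *)
Let lower_fun (f : 'I_k -> 'I_p) N w : R :=
  (3^-1 * (inverse_weight f (z w, S w) * \sum_(l < N) 4 ^+ l *
    (all (fun ij => `|value f ij w| <= half l)
      (enum {: 'I_k * 'I_q}))%:R))%R.

Let lower_fun_ge0 f N w : (0 <= lower_fun f N w)%R.
Proof.
by rewrite mulr_ge0// mulr_ge0// sumr_ge0// => l _; rewrite mulr_ge0// exprn_ge0.
Qed.

Let lower_funE f N w : (lower_fun f N w)%:E = (3^-1)%:E * \sum_(l < N)
  ((4 ^+ l)%:E * ((inverse_weight f (z w, S w))%:E *
    \prod_(ij <- enum {: 'I_k * 'I_q}) window (half l) (value f ij w))).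
Proof.
rewrite EFinM mulr_sumr -sumEFin; congr (_ * _); apply: eq_bigr => l _.
by rewrite window_prod -!EFinM; congr EFin; ring.
Qed.

Let measurable_iw f : measurable_fun setT
  (fun w => (inverse_weight f (z w, S w))%:E).
Proof.
apply/measurable_EFinP.
exact: (measurableT_comp (measurable_inverse_weight f) measurable_zS).
Qed.

Let measurable_lower_fun f N : measurable_fun setT (lower_fun f N).
Proof.
apply/measurable_EFinP; rewrite [X in measurable_fun _ X](funext (lower_funE f N)).
apply: emeasurable_funM => //; apply: emeasurable_sum => l.
by apply: emeasurable_funM => //; exact: emeasurable_funM.
Qed.

Let density_prod (f : 'I_k -> 'I_p) w : \bar R :=
  (inverse_weight f (z w, S w))%:E * \prod_(ij <- enum {: 'I_k * 'I_q})
    (window_density (minor_shift A theta f ij (z w, S w)))%:E.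

Let density_prod_ge0 f w : 0 <= density_prod f w.
Proof.
rewrite mule_ge0 ?lee_fin// prode_ge0// => ij _.
by rewrite lee_fin ltW// window_density_gt0.
Qed.

Let measurable_density_prod f : measurable_fun setT (density_prod f).
Proof.
apply: emeasurable_funM => //.
elim: (enum _) => [|ij L ihL].
  by under eq_fun do rewrite big_nil; exact: measurable_cst.
under eq_fun do rewrite big_cons.
apply: emeasurable_funM => //; apply/measurable_EFinP.
apply: (measurableT_comp measurable_window_density).
exact: (measurableT_comp (measurable_minor_shift A theta f ij) measurable_zS).
Qed.

(* At most two windows of width of order 2^-l have mass of order at least 4^-l,
   so that every scale contributes the same amount. *)
Let lower_fun_integral (f : 'I_k -> 'I_p) N : injective f -> (k * q <= 2)%N ->
  (N%:R / 3)%:E * \int[P]_w density_prod f w <= \int[P]_w (lower_fun f N w)%:E.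
Proof.
move=> fI kq2; under [leRHS]eq_integral do rewrite lower_funE.
set L := enum _.
have uL : uniq L by exact: enum_uniq.
have sL : (size L <= 2)%N by rewrite -cardE card_prod !card_ord.
have mterm l : measurable_fun setT (fun w => (4 ^+ l)%:E *
    ((inverse_weight f (z w, S w))%:E *
      \prod_(ij <- L) window (half l) (value f ij w))).
  by apply: emeasurable_funM => //; exact: emeasurable_funM.
have k4 l : 0 <= (4 ^+ l)%:E :> \bar R by rewrite lee_fin exprn_ge0.
have win0 l w : 0 <= (inverse_weight f (z w, S w))%:E *
    \prod_(ij <- L) window (half l) (value f ij w).
  by rewrite window_prod -EFinM lee_fin mulr_ge0.
have I0 : 0 <= \int[P]_w density_prod f w by exact: integral_ge0.
rewrite ge0_integralZl//; last 2 first.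
- by apply: emeasurable_sum => l; exact: mterm.
- by move=> w _; apply: sume_ge0 => l _; exact: mule_ge0.
rewrite ge0_integral_sum//; last by move=> l w _; exact: mule_ge0.
rewrite mulrC EFinM -muleA lee_wpmul2l//.
rewrite (_ : N%:R%:E * _ = \sum_(l < N) \int[P]_w density_prod f w); last first.
  elim: (N) => [|M ihM]; first by rewrite big_ord0 mul0e.
  by rewrite big_ord_recr/= -ihM -natr1 EFinD ge0_muleDl ?lee_fin// mul1e.
apply: lee_sum => l _; rewrite ge0_integralZl//; last exact: emeasurable_funM.
rewrite value_integral//.
have hl1 : (half l <= 1)%R by rewrite exprn_ile1// invf_le1// ler1n.
pose t : R := (2 * half l)%R.
have t_gt0 : (0 < t)%R by rewrite mulr_gt0// exprn_gt0.
have massL w : (t ^+ size L)%:E *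
    \prod_(ij <- L) (window_density (minor_shift A theta f ij (z w, S w)))%:E <=
    \prod_(ij <- L) window_mass (half l) (minor_shift A theta f ij (z w, S w)).
  elim: (L) => [|ij L' ihL]; first by rewrite !big_nil mule1.
  rewrite !big_cons/= exprS EFinM muleACA lee_pmul//.
  - by rewrite -EFinM lee_fin mulr_ge0 ?(ltW t_gt0) ?(ltW (window_density_gt0 _)).
  - apply: mule_ge0; first by rewrite lee_fin exprn_ge0// ltW.
    by apply: prode_ge0 => ij' _; rewrite lee_fin ltW// window_density_gt0.
  - by rewrite muleC -EFinM window_mass_lb// half_ge0.
(* Here 4^l t^2 = 4 exactly, and there are at most two windows: for t <= 1 the power is at least
   t^2, otherwise it is at least 1. *)
have t1 : (1 <= 4 ^+ l * t ^+ size L)%R.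
  have tl : (4 ^+ l * t ^+ 2 = 4)%R.
    rewrite /t exprMn -[(half l ^+ 2)%R]exprM mulnC exprM mulrCA -exprMn.
    by rewrite (_ : 4 * 2^-1 ^+ 2 = 1 :> R)%R ?expr1n; [ring|field].
  have [t2|t2] := leP t 1%R.
    rewrite (@le_trans _ _ 4%R) ?ler1n// -[leLHS]tl ler_pM2l ?exprn_gt0//.
    by rewrite ler_wiXn2l// ltW.
  rewrite (@le_trans _ _ (4 ^+ l)%R) ?exprn_ege1 ?ler1n//.
  by rewrite ler_peMr ?exprn_ge0// exprn_ege1// ltW.
rewrite -ge0_integralZl//; last 2 first.
- apply: emeasurable_funM => //; elim: (L) => [|ij L' ihL].
    by under eq_fun do rewrite big_nil; exact: measurable_cst.
  under eq_fun do rewrite big_cons.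
  apply: emeasurable_funM => //.
  apply: (measurableT_comp (measurable_window_mass _)).
  exact: (measurableT_comp (measurable_minor_shift A theta f ij) measurable_zS).
- move=> w _; rewrite mule_ge0 ?lee_fin// prode_ge0// => ij _.
  exact: window_mass_ge0.
apply: nonneg_le_integral => // w.
rewrite /density_prod muleCA lee_wpmul2l ?lee_fin//.
apply: le_trans (lee_wpmul2l (k4 l) (massL w)); rewrite muleA -EFinM.
rewrite -[leLHS]mul1e lee_wpmul2r ?lee_fin// prode_ge0// => ij _.
by rewrite lee_fin ltW// window_density_gt0.
Qed.

Let lower_fun_le f N : (k * q <= 2)%N ->
  {ae P, forall w, (lower_fun f N w <= (F w)^-1)%R}.
Proof.
move=> kq2; apply: filterS3 rankY stat_F_neq0 minor_value_neq0 => w rY F0 val0.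
have Fp : (0 < F w)%R by rewrite lt0r F0 F_ge0.
rewrite /lower_fun /inverse_weight/=; case: ifPn => [uG|_]; last first.
  by rewrite mul0r mulr0 invr_ge0 ltW.
have Fup : (F w <= minor_weight A f (S w) * \sum_ij value f ij w ^+ 2)%R.
  by rewrite -fnorm2_minor_value//; exact: stat_F_upper.
have card2 : (#|{: 'I_k * 'I_q}| <= 2)%N by rewrite card_prod !card_ord.
set rho := (\sum_ij _)%R in Fup.
have rho_ge0 : (0 <= rho)%R by apply: sumr_ge0 => ij _; exact: sqr_ge0.
have Dp : (0 < minor_weight A f (S w) * rho)%R by exact: lt_le_trans Fup.
have rho0 : (0 < rho)%R.
  by rewrite lt0r rho_ge0 andbT; apply: contraTneq Dp => ->; rewrite mulr0 ltxx.
have D0 : (0 < minor_weight A f (S w))%R by rewrite -(pmulr_lgt0 _ rho0).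
rewrite gtr0_norm//; have := dyadic_le_inv N card2 rho0.
set s := (\sum_(l < N) _)%R; rewrite -/rho => srho.
apply: (@le_trans _ _ (3^-1 * ((minor_weight A f (S w))^-1 * (3 / rho))))%R.
  by rewrite ler_wpM2l// ler_wpM2l// invr_ge0 ltW.
rewrite (_ : _ * _ = (minor_weight A f (S w) * rho)^-1)%R.
  by rewrite lef_pV2 ?posrE.
by field; rewrite !gt_eqF.
Qed.

Lemma inverse_statF_lower (C : R) : (k * q <= 2)%N ->
  exists h : T -> R, [/\ measurable_fun setT h, forall w, (0 <= h w)%R,
    {ae P, forall w, (h w <= (F w)^-1)%R} & C%:E < \int[P]_w (h w)%:E].
Proof.
move=> kq2.
have [f fI I_gt0] : exists2 f : {ffun 'I_k -> 'I_p}, injective f &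
    0 < \int[P]_w density_prod f w.
  (* If every injective [f] had integral 0, its integrand would vanish almost everywhere; yet at
     almost every point [stat_lower] yields an injective [f] where it is positive. *)
  apply: contrapT => nf.
  have nunit : {ae P, forall w, forall f : {ffun 'I_k -> 'I_p},
      density_prod f w = 0 \/ ~ injective f}.
    apply: filter_forall => f; have [fI|nfI] := pselect (injective f); last first.
      by apply: aeW => w; right.
    have I0 : \int[P]_w density_prod f w = 0.
      apply/eqP; rewrite eq_le integral_ge0// andbT leNgt; apply/negP => I_gt0.
      by apply: nf; exists f.
    have /ae_eq_integral_abs : measurable_fun setT (density_prod f) by [].
    move=> /(_ P measurableT)[+ _].
    under eq_integral do rewrite gee0_abs//.
    move=> /(_ I0); apply: filterS => w /(_ Logic.I) h; by left.
  have nrank : {ae P, forall w : T, False}.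
    have Dpos (f : {ffun 'I_k -> 'I_p}) : {ae P, forall w,
        minor_gram A f (S w) \in unitmx ->
        (0 < minor_weight A f (S w))%R}.
      apply: filterS3 rankY stat_F_neq0 minor_value_neq0 => w rY F0 val0 uG.
      have Fp : (0 < F w)%R by rewrite lt0r F0 F_ge0.
      have Fup : (F w <= minor_weight A f (S w) *
          fnorm2 (minor_coef A f (S w) *m invmx A *m X w))%R.
        exact: stat_F_upper.
      have := lt_le_trans Fp Fup; rewrite pmulr_lgt0//.
      rewrite lt0r fnorm2_ge0 andbT; apply: contraTneq Fp => fn0.
      by rewrite -leNgt -(mulr0 (minor_weight A f (S w))) -fn0.
    have Dall : {ae P, forall w, forall f : {ffun 'I_k -> 'I_p},
        minor_gram A f (S w) \in unitmx -> (0 < minor_weight A f (S w))%R}.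
      by apply: filter_forall => f; exact: Dpos.
    apply: filterS3 rankY nunit Dall => w rY dens0 Dp.
    have [f [uG _]] := stat_lower rY.
    have fI := minor_gram_inj uG.
    have [|//] := dens0 f; apply/eqP; rewrite mule_eq0 negb_or.
    rewrite eqe /inverse_weight/= uG invr_eq0 normr_eq0 gt_eqF ?Dp//=.
    elim: (enum _) => [|ij L ihL]; first by rewrite big_nil eqe oner_eq0.
    by rewrite big_cons mule_eq0 negb_or ihL andbT eqe gt_eqF// window_density_gt0.
  have [N [mN PN subN]] := nrank.
  have NT : N = setT by apply/seteqP; split=> // w _; apply: subN.
  have : P setT = 0 by rewrite -NT.
  by rewrite probability_setT => /eqP; rewrite onee_eq0.
have [e e0 eI] : exists2 e : R, (0 < e)%R & e%:E <= \int[P]_w density_prod f w.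
  move: I_gt0; case: (\int[P]_w _) => [x|_|//]; last by exists 1%R; rewrite ?leey.
  by rewrite lte_fin => x0; exists x.
(* Each of the [N] scales contributes at least e / 3, so this many exceed [C]. *)
pose N := (Num.truncn (3 * `|C| / e)%R).+1.
exists (lower_fun f N); split => //; first exact: lower_fun_le.
apply: lt_le_trans (lower_fun_integral N fI kq2).
apply: (@lt_le_trans _ _ ((N%:R / 3)%:E * e%:E)); last first.
  by rewrite lee_wpmul2l// lee_fin divr_ge0.
rewrite -EFinM lte_fin (le_lt_trans (ler_norm C))//.
have : (3 * `|C| / e < N%:R)%R by exact: truncnS_gt.
by rewrite ltr_pdivrMr// => h; lra.
Qed.

End inverse_statistic.

(** Rank at least k means that some principal minor of size r >= k of the Gram matrix is invertible,
    a finite union of measurable events. It lets a null complement become probability 1. *)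
Lemma measurable_rank_gram {R : realType} {d : measure_display}
    {T : measurableType d} {m p : nat} (Y : T -> 'M[R]_(m, p)) (B : pred nat) :
  measurable_fun setT Y -> measurable [set w | B (\rank (gram (Y w)))].
Proof.
move=> mY.
have mG : measurable_fun setT (fun w => gram (Y w)).
  by apply: measurable_fun_mulmx => //; exact: measurable_fun_trmx.
have mge k : measurable [set w | (k <= \rank (gram (Y w)))%N].
  rewrite (_ : [set w | _] = \bigcup_(r in [set r : 'I_p.+1 | (k <= r)%N])
      \bigcup_(f in [set: {ffun 'I_r -> 'I_p}])
        [set w | mxsub f f (gram (Y w)) \in unitmx]).
    apply: fin_bigcup_measurable => // r _; apply: fin_bigcup_measurable => // f _.
    rewrite (_ : [set w | _] =
        (fun w => \det (mxsub f f (gram (Y w)))) @^-1` (~` [set 0])).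
      rewrite -[X in measurable X]setTI.
      have mdet : measurable_fun setT (fun w => \det (mxsub f f (gram (Y w)))).
        by apply: measurable_fun_det; exact: measurable_fun_mxsub.
      by apply: mdet => //; apply: measurableC; exact: measurable_set1.
    by apply/seteqP; split=> w /=; rewrite unitmxE unitfE => ?; exact/eqP.
  apply/seteqP; split=> w /=.
    rewrite rank_gram => kr.
    have rp : (\rank (Y w) < p.+1)%N by rewrite ltnS rank_leq_col.
    exists (Ordinal rp) => //.
    by have [f [uf _]] := gram_minor_ex (erefl (\rank (Y w))); exists f.
  move=> [r /= kr [f _ uf]]; rewrite (leq_trans kr)// -{1}(mxrank_unit uf).
  rewrite mxsubrc (leq_trans (mxrankS (rowsub_sub _ _)))//.
  by rewrite -mxrank_tr trmx_mxsub (leq_trans (mxrankS (rowsub_sub _ _)))// mxrank_tr.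
rewrite (_ : [set w | _] = \bigcup_(k in [set k | B k])
    ([set w | (k <= \rank (gram (Y w)))%N] `\`
     [set w | (k.+1 <= \rank (gram (Y w)))%N])).
  by apply: bigcup_measurable => k _; exact: measurableD.
apply/seteqP; split=> w /=.
  by move=> Bw; exists (\rank (gram (Y w))) => //; split=> //=; rewrite ltnn.
move=> [k /= Bk [/= kr /negP]]; rewrite -ltnNge ltnS => rk.
by rewrite (_ : \rank _ = k)//; apply/eqP; rewrite eqn_leq rk kr.
Qed.

Theorem corollary3p2 (R : realType) (d : measure_display)
    (T : measurableType d) (P : probability T R) (n p q : nat)
    (n_ge1 : (1 <= n)%N) (p_ge1 : (1 <= p)%N) (q_ge1 : (1 <= q)%N)
    (theta : 'M[R]_(p, q)) (Sigma A : 'M[R]_p)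
    (Sigma_posdef : posdefmx Sigma) (A_sqrt : posdef_sqrt Sigma A)
    (X : {RV P >-> 'M[R]_(p, q)}) (Y : {RV P >-> 'M[R]_(n * q, p)})
    (X_normal : normal_columns P theta Sigma X)
    (Y_normal : normal_rows P (q%:R^-1 *: Sigma) Y)
    (XS_indep : independent P X (fun w => gram (Y w)))
    (r : R -> R) (c1 c2 cstar : R)
    (r_bounded : forall t : R, 0 <= r t <= c1)
    (r_derivable : forall t : R, derivable r t 1)
    (dr_bounded : forall t : R, `|r^`()%classic t| <= c2)
    (cstar_gt0 : 0 < cstar)
    (r_ge_cstar : forall t : R, 0 <= t -> cstar <= r t <= c1)
    (pnq : 1 < `|p%:Z - (n * q)%:Z|) :
  ('E_P[fun w => `|divergence (YtH r A (X w)) (whiten q A (Y w))|%R] < +oo)%E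
  <-> P [set w | (2 < q * \rank (gram (Y w)))%N] = 1%E.
Proof.
have mX : measurable_fun setT X by [].
have mY : measurable_fun setT Y by [].
have q0 : 0 < q%:R :> R by rewrite ltr0n.
have uA : A \in unitmx by case: A_sqrt => /posdefmx_unit.
have zS := normal_columns_gaussian A_sqrt X_normal XS_indep.
have sq0 : 0 < (Num.sqrt q%:R)^-1 :> R by rewrite invr_gt0 sqrtr_gt0.
(* The positive definite root of the row covariance Sigma / q. *)
pose A' : 'M[R]_p := (Num.sqrt q%:R)^-1 *: A.
have A'_sqrt : posdef_sqrt (q%:R^-1 *: Sigma) A'.
  have -> : (q%:R^-1 : R) = (Num.sqrt q%:R)^-1 ^+ 2.
    by rewrite exprVn sqr_sqrtr// ltW.
  exact: posdef_sqrtZ.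
have uA' : A' \in unitmx by case: A'_sqrt => /posdefmx_unit.
have yW := normal_rows_gaussian A'_sqrt Y_normal.
pose y w := Y w *m invmx A'.
have my : measurable_fun setT y by exact: measurable_fun_mulmx.
pose k := minn (n * q) p.
have k_gt0 : (0 < k)%N by rewrite leq_min muln_gt0 n_ge1 q_ge1.
have rankY : {ae P, forall w, \rank (Y w) = k}.
  apply: filterS (gaussian_full_rank my yW) => w.
  by rewrite mxrankMfree// row_free_unit unitmx_inv.
have Fn0 := stat_F_neq0 uA mX mY zS rankY k_gt0 q_ge1.
pose f w := `|divergence (YtH r A (X w)) (whiten q A (Y w))|.
pose F w := stat_F (X w) (gram (Y w)).
pose K2 : R := 4 * c1 * c2.
pose K1 : R := ((n * q + p)%:R + 4) * c1 ^+ 2.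
have bounds : {ae P, forall w,
    cstar ^+ 2 * (F w)^-1 - K2 <= f w <= K1 * (F w)^-1 + K2}.
  apply: filterS2 rankY Fn0 => w rY F0.
  exact: (divergence_bounds q_ge1 uA r_bounded r_derivable dr_bounded cstar_gt0
    r_ge_cstar pnq rY F0).
have c1_ge0 : 0 <= c1 by have /andP[a b] := r_bounded 0; exact: le_trans b.
have c2_ge0 : 0 <= c2 by exact: le_trans (normr_ge0 _) (dr_bounded 0).
have K2_ge0 : 0 <= K2 by rewrite !mulr_ge0.
have K1_ge0 : 0 <= K1 by rewrite mulr_ge0 ?sqr_ge0// addr_ge0.
have -> : ('E_P[f] = \int[P]_w (f w)%:E)%E by rewrite unlock.
have f_ge0 w : (0 <= (f w)%:E)%E by rewrite lee_fin normr_ge0.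
have [kq2|kq2] := leqP (k * q) 2.
  split=> [f_fin|PT].
    have [b fb] : exists b : R, (\int[P]_w (f w)%:E = b%:E)%E.
      have fn : (\int[P]_w (f w)%:E)%E \is a fin_num.
        by rewrite ge0_fin_numE// integral_ge0.
      by exists (fine (\int[P]_w (f w)%:E)%E); rewrite fineK.
    (* The threshold is what the lower divergence bound would allow for the integral of 1/F if the
       expectation were [b]. *)
    have [h [mh h0 hF hint]] := inverse_statF_lower uA mX mY zS rankY k_gt0 q_ge1
      ((b + K2) / cstar ^+ 2) kq2.
    (* Positive part, since the lower bound may be negative and only nonnegative functions are
       compared. *)
    pose g w := Num.max (cstar ^+ 2 * h w - K2) 0.
    have mg : measurable_fun setT (fun w => (g w)%:E).
      apply/measurable_EFinP; apply: measurable_maxr => //.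
      by apply: measurable_funB => //; exact: measurable_funM.
    have g0 w : (0 <= (g w)%:E)%E by rewrite lee_fin le_max lexx orbT.
    have gf : (\int[P]_w (g w)%:E <= b%:E)%E.
      rewrite -fb; apply: le_integral_ae_lower => //.
      apply: filterS2 bounds hF => w /andP[fl _] hw.
      rewrite lee_fin ge_max normr_ge0 andbT (le_trans _ fl)// lerD2r.
      by rewrite ler_pM2l// exprn_gt0.
    have : ((cstar ^+ 2)%:E * \int[P]_w (h w)%:E <= (b + K2)%:E)%E.
      rewrite -ge0_integralZl//; last 3 first.
        exact/measurable_EFinP.
        by move=> w _; rewrite lee_fin.
        by rewrite lee_fin exprn_ge0// ltW.
      apply: (@le_trans _ _ (\int[P]_w ((g w)%:E + K2%:E))%E).
        apply: nonneg_le_integral => w.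
          by rewrite -EFinM lee_fin mulr_ge0// exprn_ge0// ltW.
        by rewrite -EFinM -EFinD lee_fin -lerBlDr le_max lexx.
      rewrite ge0_integralD// EFinD leeD//.
      rewrite (integral_cst P measurableT K2%:E) -[leRHS]mule1 lee_wpmul2l//.
      exact: probability_le1.
    rewrite leNgt -lte_pdivrMl ?exprn_gt0// -EFinM mulrC.
    by rewrite hint.
  (* The rank never exceeds [k], so the event is empty, not merely null. *)
  move: PT; rewrite (_ : [set w | _] = set0).
    by rewrite measure0 => /eqP; rewrite eq_sym onee_eq0.
  apply/seteqP; split=> w //=; rewrite rank_gram ltnNge => /negP[].
  by rewrite mulnC (leq_trans _ kq2)// leq_mul2r leq_min rank_leq_row rank_leq_col orbT.
split=> _.
  pose E := [set w | (2 < q * \rank (gram (Y w)))%N].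
  have mE : measurable E.
    exact: (measurable_rank_gram (fun j => (2 < q * j)%N) mY).
  have PEc : P (~` E) = 0%E.
    apply: measure_negligible; first exact: measurableC.
    apply: negligibleS rankY => w /= nE rY; apply: nE.
    by rewrite /E/= rank_gram rY mulnC.
  have := probability_setC P mE; rewrite PEc => /esym/eqP.
  by rewrite sube_eq// add0e => /eqP.
(* Since Y = y A', tr S is at most |A'|^2 times the sum of squares of the standard normal entries of
   y. *)
have trS_fin : (\int[P]_w (\tr (gram (Y w)))%:E < +oo)%E.
  have my2 e : measurable_fun setT (fun w => (y w e.1 e.2 ^+ 2)%:E).
    by apply/measurable_EFinP; apply: measurable_funX; exact: measurable_fun_entry.
  have trE w : \tr (gram (Y w)) = fnorm2 (Y w).
    by rewrite -fnorm2_tr fnorm2_trace trmxK.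
  apply: (@le_lt_trans _ _ (\int[P]_w ((fnorm2 A')%:E *
      \sum_(e : 'I_(n * q) * 'I_p) (y w e.1 e.2 ^+ 2)%:E))%E).
    apply: nonneg_le_integral => w.
      by rewrite lee_fin trE fnorm2_ge0.
    rewrite trE; have -> : Y w = y w *m A' by rewrite /y mulmxKV.
    rewrite sumEFin -EFinM lee_fin mulrC.
    rewrite (_ : \sum_(e : _ * _) _ = fnorm2 (y w)) ?fnorm2_mul//.
    by rewrite /fnorm2 pair_bigA.
  rewrite ge0_integralZl//; last 3 first.
    exact: emeasurable_sum.
    by move=> w _; apply: sume_ge0 => e _; rewrite lee_fin sqr_ge0.
    by rewrite lee_fin fnorm2_ge0.
  rewrite lte_mul_pinfty ?lee_fin ?fnorm2_ge0// ge0_integral_sum//; last first.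
    by move=> e w _; rewrite lee_fin sqr_ge0.
  apply: lte_sum_pinfty => e _.
  exact: (entry_second_moment my (measurable_cst tt) yW).
have [G [mG G0 FG Gfin]] :=
  inverse_statF_upper uA mX mY zS rankY k_gt0 q_ge1 kq2 trS_fin.
apply: (@le_lt_trans _ _ (\int[P]_w (K1%:E * G w + K2%:E))%E).
  apply: le_integral_ae_upper => //.
  - by apply: emeasurable_funD => //; exact: emeasurable_funM.
  - by move=> w; rewrite adde_ge0 ?mule_ge0 ?lee_fin.
  - apply: filterS2 bounds FG => w /andP[_ fu] Fw.
    rewrite (@le_trans _ _ (K1 * (F w)^-1 + K2)%:E)//.
    by rewrite EFinD EFinM leeD2r// lee_wpmul2l.
rewrite ge0_integralD//; last 2 first.
  by move=> w _; rewrite mule_ge0.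
  exact: emeasurable_funM.
rewrite lte_add_pinfty//.
  by rewrite ge0_integralZl// lte_mul_pinfty ?lee_fin.
rewrite (integral_cst P measurableT K2%:E).
apply: (@le_lt_trans _ _ (K2%:E * 1)%E); last by rewrite mule1 ltry.
by rewrite lee_wpmul2l ?lee_fin//; exact: probability_le1.
Qed.
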